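(* Let $R$ be a commutative ring, let $\underline{x} = x_1,\ldots,x_k$ be a finite sequence of elements of $R$, and let $J = (x_1,\ldots,x_k)R$. For an $R$-module $M$, let $\rho_M : \mathcal{D}_J(M) \to \check{D}^0_{\underline{x}}(M)$, $\theta_M : \mathcal{D}_J(M) \to \varprojlim_{x\in J} M_x$ and $\sigma_M : \varprojlim_{x \in J} M_x \to \check{D}^0_{\underline{x}}(M)$ be the $R$-homomorphisms defined in the context. Then for every $R$-module $M$ the triangle commutes, i.e. $\rho_M = \sigma_M \circ \theta_M$, and the following hold: (1) For every $R$-module $M$, $\theta_M$ and $\rho_M$ are injective and $\sigma_M$ is an isomorphism. (2) For every $R$-module $M$, $\theta_M$ (respectively $\rho_M$) is an isomorphism if and only if $\check{H}^1_{\underline{x}}(\mathcal{D}_J(M)) = 0$. (3) $\theta_M$ (respectively $\rho_M$) is an isomorphism for every $R$-module $M$ if and only if the inverse system $\{H_1(\underline{x}^{(n)};R)\}_{n\geq 1}$ is pro-zero, i.e. for every $n \ge 1$ there is an $m \geq n$ such that the natural map $H_1(\underline{x}^{(m)};R) \to H_1(\underline{x}^{(n)};R)$ is zero.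
   Context: $R$ is a commutative ring (not necessarily Noetherian), $M$ an $R$-module, $\underline{x} = x_1,\ldots,x_k$ and $J = (x_1,\ldots,x_k)R$. Koszul homology: for $n\ge 1$ put $\underline{x}^{(n)} = x_1^n,\ldots,x_k^n$; $H_i(\underline{x}^{(n)};M)$ is the $i$-th homology of the Koszul complex $K_\cdot(\underline{x}^{(n)};M)$. For $m \ge n$ the natural map $K_\cdot(\underline{x}^{(m)};M)\to K_\cdot(\underline{x}^{(n)};M)$ is the one which is the identity in degree $0$ and sends the basis element $e_i$ in degree $1$ to $x_i^{m-n}e_i$ (extended multiplicatively to higher degrees); it induces $H_i(\underline{x}^{(m)};M)\to H_i(\underline{x}^{(n)};M)$, making $\{H_i(\underline{x}^{(n)};M)\}_{n\ge1}$ an inverse system. Čech complex: $\check{C}_{\underline{x}}(M)$ is the complex $$0\to M \xrightarrow{d^0} \bigoplus_{i=1}^k M_{x_i} \xrightarrow{d^1} \bigoplus_{1\le i<j\le k} M_{x_ix_j} \xrightarrow{d^2} \cdots \to M_{x_1\cdots x_k}\to 0$$ with $M$ in degree $0$ and the usual alternating sums of localization maps as differentials, and $\check{H}^i_{\underline{x}}(M) = H^i(\check{C}_{\underline{x}}(M))$. Further, $\check{D}^0_{\underline{x}}(M) = \ker(d^1) \subseteq \bigoplus_{i=1}^k M_{x_i}$, i.e. the families $(m_i/x_i^n)_{i=1}^k$ whose components $i$ and $j$ agree in $M_{x_ix_j}$ for all $i,j$. Ideal transform: $\mathcal{D}_J(M) = \varinjlim_n \operatorname{Hom}_R(J^n,M)$,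 with transition maps given by restriction along $J^{m}\subseteq J^{n}$, $m\ge n$. Inverse limit of localizations: for $x,y\in J$ write $y \ge x$ if $x \in \operatorname{Rad}(yR)$, i.e. $x^l = yr$ for some $l\geq 1$ and $r\in R$; then there is a well-defined homomorphism $\alpha_{x,y}: M_y \to M_x$, $m/y^n\mapsto r^n m/x^{ln}$. With these maps $\{M_x\}_{x\in J}$ is an inverse system; $\varprojlim_{x\in J} M_x$ is its inverse limit and $\alpha_x : \varprojlim_{x\in J}M_x\to M_x$ are the canonical maps. The homomorphisms: for $\phi\in\mathcal{D}_J(M)$ represented by $\phi_n\in \operatorname{Hom}_R(J^n,M)$, $$\rho_M(\phi) = (\phi_n(x_i^n)/x_i^n)_{i=1}^k,\qquad \theta_M(\phi) = (\phi_n(x^n)/x^n)_{x\in J},$$ and for $f\in\varprojlim_{x\in J}M_x$, $\sigma_M(f) = (\alpha_{x_i}(f))_{i=1}^k$. These are well defined. *)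

(* Defs.v *)
From HB Require Import structures.
From mathcomp Require Import all_boot all_algebra.
From mathcomp Require Import boolp zify ring.

Set Implicit Arguments.
Unset Strict Implicit.
Unset Printing Implicit Defensive.

Import GRing.Theory.
Local Open Scope ring_scope.
Local Open Scope quotient_scope.

Definition family (R : pzRingType) (I : Type) (V : I -> lmodType R) : Type :=
  forall i, V i.

Section FamilyLmodule.
Context (R : pzRingType) (I : Type) (V : I -> lmodType R).

HB.instance Definition _ := gen_eqMixin (family V).
HB.instance Definition _ := gen_choiceMixin (family V).

Let add (f g : family V) : family V := fun i => f i + g i.
Let opp (f : family V) : family V := fun i => - f i.
Let zero : family V := fun=> 0.
Let scale (a : R) (f : family V) : family V := fun i => a *: f i.

Let addA : associative add.
Proof. by move=> f g h; apply: functional_extensionality_dep => i; exact: addrA. Qed.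
Let addC : commutative add.
Proof. by move=> f g; apply: functional_extensionality_dep => i; exact: addrC. Qed.
Let add0 : left_id zero add.
Proof. by move=> f; apply: functional_extensionality_dep => i; exact: add0r. Qed.
Let addN : left_inverse zero opp add.
Proof. by move=> f; apply: functional_extensionality_dep => i; exact: addNr. Qed.

HB.instance Definition _ :=
  GRing.isZmodule.Build (family V) addA addC add0 addN.

Let scaleA a b f : scale a (scale b f) = scale (a * b) f.
Proof. by apply: functional_extensionality_dep => i; exact: scalerA. Qed.
Let scale1 : left_id 1 scale.
Proof. by move=> f; apply: functional_extensionality_dep => i; exact: scale1r. Qed.
Let scaleDr : right_distributive scale +%R.
Proof. by move=> a f g; apply: functional_extensionality_dep => i; exact: scalerDr. Qed.
Let scaleDl f : {morph scale^~ f : a b / a + b}.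
Proof. by move=> a b; apply: functional_extensionality_dep => i; exact: scalerDl. Qed.

HB.instance Definition _ :=
  GRing.Zmodule_isLmodule.Build R (family V) scaleA scale1 scaleDr scaleDl.

Lemma familyD (f g : family V) i : (f + g) i = f i + g i. Proof. by []. Qed.
Lemma familyN (f : family V) i : (- f) i = - f i. Proof. by []. Qed.
Lemma familyZ a (f : family V) i : (a *: f) i = a *: f i. Proof. by []. Qed.
Lemma family0 i : (0 : family V) i = 0. Proof. by []. Qed.

End FamilyLmodule.

Section HomLmodule.
Context (R : comPzRingType) (U V : lmodType R).

HB.instance Definition _ := gen_eqMixin {linear U -> V}.
HB.instance Definition _ := gen_choiceMixin {linear U -> V}.

Lemma hom_ext (f g : {linear U -> V}) : f =1 g -> f = g.
Proof.
case: f g => f [[f1] [f2]] [g [[g1] [g2]]] /= fg.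
have {}fg : f = g by apply: functional_extensionality_dep.
subst g; congr (GRing.Linear.Pack (GRing.Linear.Class _ _)).
  by congr GRing.isNmodMorphism.phant_Build; exact: Prop_irrelevance.
by congr GRing.isScalable.phant_Build; exact: Prop_irrelevance.
Qed.

Let add (f g : {linear U -> V}) : {linear U -> V} := f \+ g.
Let opp (f : {linear U -> V}) : {linear U -> V} := \- f.
Let zero : {linear U -> V} := \0.
Let scale (a : R) (f : {linear U -> V}) : {linear U -> V} := a \*: f.

Let addA : associative add.
Proof. by move=> f g h; apply: hom_ext => u; exact: addrA. Qed.
Let addC : commutative add.
Proof. by move=> f g; apply: hom_ext => u; exact: addrC. Qed.
Let add0 : left_id zero add.
Proof. by move=> f; apply: hom_ext => u; exact: add0r. Qed.
Let addN : left_inverse zero opp add.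
Proof. by move=> f; apply: hom_ext => u; exact: addNr. Qed.

HB.instance Definition _ :=
  GRing.isZmodule.Build {linear U -> V} addA addC add0 addN.

Let scaleA a b f : scale a (scale b f) = scale (a * b) f.
Proof. by apply: hom_ext => u; exact: scalerA. Qed.
Let scale1 : left_id 1 scale.
Proof. by move=> f; apply: hom_ext => u; exact: scale1r. Qed.
Let scaleDr : right_distributive scale +%R.
Proof. by move=> a f g; apply: hom_ext => u; exact: scalerDr. Qed.
Let scaleDl f : {morph scale^~ f : a b / a + b}.
Proof. by move=> a b; apply: hom_ext => u; exact: scalerDl. Qed.

HB.instance Definition _ := GRing.Zmodule_isLmodule.Build R {linear U -> V}
  scaleA scale1 scaleDr scaleDl.

Lemma homD (f g : {linear U -> V}) u : (f + g) u = f u + g u. Proof. by []. Qed.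
Lemma homN (f : {linear U -> V}) u : (- f) u = - f u. Proof. by []. Qed.
Lemma homZ a (f : {linear U -> V}) u : (a *: f) u = a *: f u. Proof. by []. Qed.

End HomLmodule.

(* A carrier with module operations that satisfy the module axioms only up to
   an equivalence relation. The opposite is scaling by -1. *)
Record premodule (R : pzRingType) := Premodule {
  pm_sort :> choiceType;
  pm_eqv : pm_sort -> pm_sort -> Prop;
  pm_zero : pm_sort;
  pm_add : pm_sort -> pm_sort -> pm_sort;
  pm_scale : R -> pm_sort -> pm_sort;
  pm_refl : forall p, pm_eqv p p;
  pm_sym : forall p q, pm_eqv p q -> pm_eqv q p;
  pm_trans : forall p q r, pm_eqv p q -> pm_eqv q r -> pm_eqv p r;
  pm_addP : forall p p' q q', pm_eqv p p' -> pm_eqv q q' ->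
    pm_eqv (pm_add p q) (pm_add p' q');
  pm_scaleP : forall a p p', pm_eqv p p' -> pm_eqv (pm_scale a p) (pm_scale a p');
  pm_addA : forall p q r,
    pm_eqv (pm_add p (pm_add q r)) (pm_add (pm_add p q) r);
  pm_addC : forall p q, pm_eqv (pm_add p q) (pm_add q p);
  pm_add0 : forall p, pm_eqv (pm_add pm_zero p) p;
  pm_scale0 : forall p, pm_eqv (pm_scale 0 p) pm_zero;
  pm_scale1 : forall p, pm_eqv (pm_scale 1 p) p;
  pm_scaleA : forall a b p,
    pm_eqv (pm_scale a (pm_scale b p)) (pm_scale (a * b) p);
  pm_scaleDr : forall a p q,
    pm_eqv (pm_scale a (pm_add p q)) (pm_add (pm_scale a p) (pm_scale a q));
  pm_scaleDl : forall a b p,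
    pm_eqv (pm_scale (a + b) p) (pm_add (pm_scale a p) (pm_scale b p))
}.

Section Quotient.
Context (R : pzRingType) (P : premodule R).

Let eqvb : rel P := fun p q => `[< pm_eqv p q >].

Let eqvb_refl : reflexive eqvb.
Proof. by move=> p; apply/asboolP; exact: pm_refl. Qed.
Let eqvb_sym : symmetric eqvb.
Proof. by move=> p q; apply/asboolP/asboolP; exact: pm_sym. Qed.
Let eqvb_trans : transitive eqvb.
Proof.
by move=> q p r /asboolP pq /asboolP qr; apply/asboolP; exact: pm_trans qr.
Qed.

Definition premodule_equiv : equiv_rel P :=
  EquivRel eqvb eqvb_refl eqvb_sym eqvb_trans.

Definition quotient : Type := {eq_quot premodule_equiv}.

HB.instance Definition _ := Choice.on quotient.

Definition class (p : P) : quotient := \pi_{eq_quot premodule_equiv} p.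

Let rep (u : quotient) : P := repr (u : {eq_quot premodule_equiv}).

Lemma class_eqP (p q : P) : class p = class q <-> pm_eqv p q.
Proof.
split=> [/eqquotP /asboolP //|pq]; apply/eqquotP; exact/asboolP.
Qed.

Lemma class_repr (u : quotient) : class (rep u) = u.
Proof. exact: reprK. Qed.

Lemma repr_class (p : P) : pm_eqv (rep (class p)) p.
Proof. by apply/class_eqP; rewrite class_repr. Qed.

Lemma quotient_ind (Q : quotient -> Prop) : (forall p, Q (class p)) ->
  forall u, Q u.
Proof. by move=> Qc u; rewrite -(class_repr u). Qed.

Let zero : quotient := class (pm_zero P).
Let add (u v : quotient) : quotient := class (pm_add (rep u) (rep v)).
Let scale (a : R) (u : quotient) : quotient := class (pm_scale a (rep u)).
Let opp (u : quotient) : quotient := scale (- 1) u.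

Let addE p q : add (class p) (class q) = class (pm_add p q).
Proof. by apply/class_eqP; apply: pm_addP; exact: repr_class. Qed.
Let scaleE a p : scale a (class p) = class (pm_scale a p).
Proof. by apply/class_eqP; apply: pm_scaleP; exact: repr_class. Qed.

Let addA : associative add.
Proof.
elim/quotient_ind=> p; elim/quotient_ind=> q; elim/quotient_ind=> r.
by rewrite !addE; apply/class_eqP; exact: pm_addA.
Qed.
Let addC : commutative add.
Proof.
elim/quotient_ind=> p; elim/quotient_ind=> q.
by rewrite !addE; apply/class_eqP; exact: pm_addC.
Qed.
Let add0 : left_id zero add.
Proof.
by elim/quotient_ind=> p; rewrite addE; apply/class_eqP; exact: pm_add0.
Qed.
Let addN : left_inverse zero opp add.
Proof.
elim/quotient_ind=> p; rewrite /opp scaleE addE; apply/class_eqP.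
apply: pm_trans (pm_scale0 p); rewrite -(addNr 1).
apply: pm_trans (pm_sym (pm_scaleDl _ _ _)).
by apply: pm_addP (pm_refl _) (pm_sym (pm_scale1 _)).
Qed.

HB.instance Definition _ := GRing.isZmodule.Build quotient addA addC add0 addN.

Let scaleA a b u : scale a (scale b u) = scale (a * b) u.
Proof.
elim/quotient_ind: u => p; rewrite !scaleE; apply/class_eqP; exact: pm_scaleA.
Qed.
Let scale1 : left_id 1 scale.
Proof.
by elim/quotient_ind=> p; rewrite scaleE; apply/class_eqP; exact: pm_scale1.
Qed.
Let scaleDr : right_distributive scale +%R.
Proof.
move=> a; elim/quotient_ind=> p; elim/quotient_ind=> q.
have -> : class p + class q = class (pm_add p q) by exact: addE.
rewrite !scaleE [RHS]addE.
by apply/class_eqP; exact: pm_scaleDr.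
Qed.
Let scaleDl u : {morph scale^~ u : a b / a + b}.
Proof.
elim/quotient_ind: u => p a b; rewrite !scaleE [RHS]addE.
by apply/class_eqP; exact: pm_scaleDl.
Qed.

HB.instance Definition _ :=
  GRing.Zmodule_isLmodule.Build R quotient scaleA scale1 scaleDr scaleDl.

Lemma class0 : class (pm_zero P) = 0. Proof. by []. Qed.
Lemma classD p q : class (pm_add p q) = class p + class q.
Proof. by rewrite -addE. Qed.
Lemma classZ a p : class (pm_scale a p) = a *: class p.
Proof. by rewrite -scaleE. Qed.

Section Lift.
Context (V : lmodType R) (f : P -> V).
Context (f_compat : forall p q, pm_eqv p q -> f p = f q).
Context (f_linear :
  forall a p q, f (pm_add (pm_scale a p) q) = a *: f p + f q).

Definition lift_fun (u : quotient) : V := f (rep u).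

Let lift_funE p : lift_fun (class p) = f p.
Proof. by apply: f_compat; exact: repr_class. Qed.

Let lift_linear : linear lift_fun.
Proof.
move=> a; elim/quotient_ind=> p; elim/quotient_ind=> q.
by rewrite -classZ -classD !lift_funE f_linear.
Qed.

Definition lift : {linear quotient -> V} :=
  HB.pack_for {linear quotient -> V} lift_fun
    (GRing.isLinear.Build R quotient V *:%R lift_fun lift_linear).

Lemma liftE p : lift (class p) = f p.
Proof. exact: lift_funE. Qed.

End Lift.
End Quotient.

Section Kernel.
Context (R : pzRingType) (U V : lmodType R) (d : {linear U -> V}).

Definition ker : {pred U} := [pred u | d u == 0].

Let ker_submod_closed : submod_closed ker.
Proof.
split=> [|a u v]; rewrite !inE ?linear0 // => /eqP du /eqP dv.
by rewrite linearP du dv scaler0 addr0.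
Qed.

HB.instance Definition _ := GRing.isSubmodClosed.Build R U ker
  ker_submod_closed.

Record kernel : Type := Kernel { kernel_val : U; _ : kernel_val \in ker }.

HB.instance Definition _ := [isSub for kernel_val].
HB.instance Definition _ := [Choice of kernel by <:].
HB.instance Definition _ := [SubChoice_isSubLmodule of kernel by <:].

Lemma kernelP (z : kernel) : d (kernel_val z) = 0.
Proof. by case: z => u /= /eqP. Qed.

End Kernel.

Section Homology.
Context (R : pzRingType) (A B C : lmodType R).
Context (d' : {linear A -> B}) (d : {linear B -> C}).

Definition homologous (z z' : kernel d) : Prop :=
  exists a, d' a = val z - val z'.

Let homologous_refl z : homologous z z.
Proof. by exists 0; rewrite linear0 subrr. Qed.
Let homologous_sym z z' : homologous z z' -> homologous z' z.
Proof. by case=> a da; exists (- a); rewrite linearN da opprB. Qed.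
Let homologous_trans z1 z2 z3 :
  homologous z1 z2 -> homologous z2 z3 -> homologous z1 z3.
Proof.
by case=> a da [b db]; exists (a + b); rewrite linearD da db addrA subrK.
Qed.
Let homologousD z1 z1' z2 z2' : homologous z1 z1' -> homologous z2 z2' ->
  homologous (z1 + z2) (z1' + z2').
Proof.
case=> a da [b db]; exists (a + b).
by rewrite linearD da db !linearD addrACA.
Qed.
Let homologousZ r z z' : homologous z z' -> homologous (r *: z) (r *: z').
Proof. by case=> a da; exists (r *: a); rewrite linearZ /= da scalerBr !linearZ. Qed.

Let homologous_eq z z' : z = z' -> homologous z z'.
Proof. by move->. Qed.

Definition homology_premodule : premodule R := @Premodule R (kernel d)
  homologous 0 +%R *:%R homologous_refl homologous_sym homologous_trans
  homologousD homologousZ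
  (fun p q r => homologous_eq (addrA p q r))
  (fun p q => homologous_eq (addrC p q))
  (fun p => homologous_eq (add0r p))
  (fun p => homologous_eq (scale0r p))
  (fun p => homologous_eq (scale1r p))
  (fun a b p => homologous_eq (scalerA a b p))
  (fun a p q => homologous_eq (scalerDr a p q))
  (fun a b p => homologous_eq (scalerDl p a b)).

(* ker d / im d' for A -d'-> B -d-> C, where d' takes values in ker d *)
Definition homology := quotient homology_premodule.

Definition homology_class (z : kernel d) : homology :=
  class (z : homology_premodule).

Lemma homology_class_eq0 z : homology_class z = 0 <-> exists a, d' a = val z.
Proof.
have v0 : val (0 : kernel d) = 0 by exact: linear0.
have eqv0 : homologous z 0 <-> exists a, d' a = val z.
  by rewrite /homologous v0 subr0.
by rewrite -eqv0; exact: (@class_eqP R homology_premodule z 0).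
Qed.

End Homology.

Section HomologyMap.
Context (R : pzRingType) (A B C A2 B2 C2 : lmodType R).
Context (d' : {linear A -> B}) (d : {linear B -> C}).
Context (e' : {linear A2 -> B2}) (e : {linear B2 -> C2}).
Context (f' : {linear A -> A2}) (f : {linear B -> B2}) (f0 : {linear C -> C2}).
Context (comm' : forall a, f (d' a) = e' (f' a)).
Context (comm : forall b, f0 (d b) = e (f b)).

Let ker_map_subproof (z : kernel d) : f (val z) \in ker e.
Proof. by rewrite inE -comm kernelP linear0. Qed.

Definition kernel_map (z : kernel d) : kernel e := Kernel (ker_map_subproof z).

Let kernel_map_compat z z' : homologous d' z z' ->
  homology_class e' (kernel_map z) = homology_class e' (kernel_map z').
Proof.
case=> a da; apply/class_eqP; exists (f' a).
by rewrite -comm' da linearB.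
Qed.

Let kernel_map_linear a z z' :
  homology_class e' (kernel_map (a *: z + z')) =
  a *: homology_class e' (kernel_map z) + homology_class e' (kernel_map z').
Proof.
rewrite /homology_class -classZ -classD; congr class; apply: val_inj => /=.
by rewrite linearP.
Qed.

Definition homology_map : {linear homology d' d -> homology e' e} :=
  @lift R (homology_premodule d' d) (homology e' e)
    (fun z => homology_class e' (kernel_map z))
    kernel_map_compat kernel_map_linear.

Lemma homology_mapE z :
  homology_map (homology_class d' z) = homology_class e' (kernel_map z).
Proof. exact: liftE. Qed.

End HomologyMap.

Section Koszul.
Context (R : comPzRingType) (k : nat) (M : lmodType R).

(* The p-subset T = {i_1 < ... < i_p} of 'I_k stands for the basis element
   e_{i_1} /\ ... /\ e_{i_p}, so that K_p(y; M) is the module of functions from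
   p-subsets of 'I_k to M. *)
Definition psubset (p : nat) : Type := {T : {set 'I_k} | #|T| == p}.
Definition koszul (p : nat) : Type := {ffun psubset p -> M}.
HB.instance Definition _ p := GRing.Lmodule.on (koszul p).

Definition koszul_coef p (f : koszul p) (T : {set 'I_k}) : M :=
  oapp f 0 (insub T).

Lemma koszul_coefP p a (f g : koszul p) T :
  koszul_coef (a *: f + g) T = a *: koszul_coef f T + koszul_coef g T.
Proof.
rewrite /koszul_coef; case: insubP => [u _ _|_] /=; first by rewrite !ffunE.
by rewrite scaler0 addr0.
Qed.

Lemma koszul_coef_val p (f : koszul p) (T : psubset p) :
  koszul_coef f (val T) = f T.
Proof. by rewrite /koszul_coef valK. Qed.

Lemma koszul_coef_out p (f : koszul p) (T : {set 'I_k}) : #|T| != p -> koszul_coef f T = 0.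
Proof. by move=> nT; rewrite /koszul_coef insubN. Qed.

Definition koszul_sign (i : 'I_k) (T : {set 'I_k}) : R :=
  (-1) ^+ #|[set j in T | (j < i)%N]|.

Section Differential.
Context (y : 'I_k -> R).

(* d (m e_S) = \sum_(i in S) (-1)^#{j in S | j < i} y_i m e_(S \ i), read off
   at the basis element e_T. It is the Koszul differential for p = q + 1;
   for other p and q, in particular for p = q = 0, it is the zero map. *)
Definition koszul_diff_fun p q (f : koszul p) : koszul q :=
  [ffun T : psubset q => \sum_(i | i \notin val T)
     (koszul_sign i (val T) * y i) *: koszul_coef f (i |: val T)].

Let koszul_diff_linear p q : linear (@koszul_diff_fun p q).
Proof.
move=> a f g; apply/ffunP=> T; rewrite !ffunE scaler_sumr -big_split /=.
apply: eq_bigr => i _; rewrite koszul_coefP scalerDr; congr (_ + _).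
by rewrite !scalerA mulrC.
Qed.

HB.instance Definition _ p q := GRing.isLinear.Build R (koszul p) (koszul q)
  *:%R (@koszul_diff_fun p q) (@koszul_diff_linear p q).

Definition koszul_diff p q : {linear koszul p -> koszul q} :=
  @koszul_diff_fun p q.

Definition koszul_homology (p : nat) : lmodType R :=
  homology (koszul_diff p.+1 p) (koszul_diff p p.-1).

End Differential.

Lemma koszul_diff_out y p q (f : koszul p) : p != q.+1 ->
  koszul_diff y p q f = 0.
Proof.
move=> npq; apply/ffunP=> T; rewrite !ffunE big1 // => i iT.
rewrite koszul_coef_out ?scaler0 // cardsU1 iT (eqP (valP T)) add1n.
by rewrite eq_sym.
Qed.

End Koszul.

Section KoszulComplex.
Context (R : comPzRingType) (k : nat) (M : lmodType R) (y : 'I_k -> R).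

Let koszul_signU (i j : 'I_k) (T : {set 'I_k}) : i \notin T ->
  koszul_sign R j (i |: T) = (-1) ^+ (i < j)%N * koszul_sign R j T.
Proof.
move=> iT; rewrite /koszul_sign; case: ltnP => ij.
  rewrite -exprD; congr (_ ^+ _).
  have -> : [set t in i |: T | (t < j)%N] = i |: [set t in T | (t < j)%N].
    by apply/setP=> t; rewrite !inE; case: eqP => [->|].
  by rewrite cardsU1 !inE (negbTE iT).
rewrite mul1r; congr (_ ^+ #|pred_of_set _|); apply/setP=> t; rewrite !inE.
by case: eqP => //= ->; rewrite ltnNge ij andbF.
Qed.

Lemma koszul_diff_diff p q r (f : koszul k M p) :
  koszul_diff M y q r (koszul_diff M y p q f) = 0.
Proof.
have [qr|nqr] := eqVneq q r.+1; last exact: koszul_diff_out.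
apply/ffunP=> T; rewrite !ffunE.
pose g i j := (koszul_sign R i (val T) * y i * (koszul_sign R j (i |: val T)
  * y j)) *: koszul_coef f (j |: (i |: val T)).
pose A i j := [&& i \notin val T, j \notin val T & i != j].
have -> : \sum_(i | i \notin val T) (koszul_sign R i (val T) * y i) *:
    koszul_coef (koszul_diff M y p q f) (i |: val T) =
  \sum_i \sum_(j | A i j) g i j.
  rewrite big_mkcond; apply: eq_bigr => i _; rewrite /A.
  case: ifPn => iT /=; last by rewrite big_pred0.
  have iTq : #|i |: val T| == q by rewrite cardsU1 iT (eqP (valP T)) qr.
  rewrite {1}/koszul_coef (insubT (fun T : {set 'I_k} => #|T| == q) iTq) /=.
  rewrite ffunE scaler_sumr; apply: eq_big => [j|j _].
    by rewrite !inE negb_or andbC eq_sym.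
  by rewrite scalerA.
have gC i j : A i j -> g i j = - g j i.
  case/and3P=> iT jT ij; rewrite /g setUCA -scaleNr; congr (_ *: _).
  rewrite !koszul_signU //; move: ij; rewrite -val_eqE /=.
  case: ltngtP => // _ _; rewrite !(expr0, expr1); ring.
rewrite (eq_bigr (fun i => \sum_(j | A i j && (i < j)%N) g i j +
  \sum_(j | A i j && ~~ (i < j)%N) g i j)); last first.
  by move=> i _; rewrite (bigID (fun j : 'I_k => (i < j)%N)).
rewrite big_split /= [X in _ + X](exchange_big_dep xpredT) //= -big_split /=.
rewrite big1 // => i _.
rewrite [X in _ + X](eq_big (fun j => A i j && (i < j)%N) (fun j => - g i j)).
- by rewrite sumrN subrr.
- move=> j; rewrite /A -leqNgt leq_eqVlt -!val_eqE /=.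
  by case: ltngtP; rewrite ?andbF //= !andbT andbC.
- by move=> j /andP[/gC ->].
Qed.

End KoszulComplex.

Section KoszulPowers.
Context (R : comPzRingType) (k : nat) (x : 'I_k -> R) (M : lmodType R).

Definition powers (n : nat) : 'I_k -> R := fun i => x i ^+ n.

Section Transition.
Context (m n : nat).

(* e_(i_1) /\ ... /\ e_(i_p) |-> (x_(i_1) ... x_(i_p))^(m - n) times itself *)
Definition koszul_trans_fun p (f : koszul k M p) : koszul k M p :=
  [ffun T : psubset k p => (\prod_(i in val T) x i ^+ (m - n)) *: f T].

Let koszul_trans_linear p : linear (@koszul_trans_fun p).
Proof.
move=> a f g; apply/ffunP=> T; rewrite !ffunE scalerDr; congr (_ + _).
by rewrite !scalerA mulrC.
Qed.

HB.instance Definition _ p := GRing.isLinear.Build R (koszul k M p)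
  (koszul k M p) *:%R (@koszul_trans_fun p) (@koszul_trans_linear p).

Definition koszul_trans p : {linear koszul k M p -> koszul k M p} :=
  @koszul_trans_fun p.

Lemma koszul_trans_diff p q (f : koszul k M p) : (n <= m)%N ->
  koszul_trans q (koszul_diff M (powers m) p q f) =
  koszul_diff M (powers n) p q (koszul_trans p f).
Proof.
move=> nm; apply/ffunP=> T; rewrite !ffunE scaler_sumr.
apply: eq_bigr => i iT.
have -> : koszul_coef (koszul_trans p f) (i |: val T) =
    (\prod_(j in i |: val T) x j ^+ (m - n)) *: koszul_coef f (i |: val T).
  rewrite /koszul_coef; case: insubP => [u _ <-|_] /=; first by rewrite ffunE.
  by rewrite scaler0.
rewrite big_setU1 //= !scalerA; congr (_ *: _).
have -> : powers m i = x i ^+ n * x i ^+ (m - n).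
  by rewrite -exprD subnKC.
by rewrite mulrC -!mulrA.
Qed.

End Transition.

Definition koszul_map m n (nm : (n <= m)%N) p :
    {linear koszul_homology M (powers m) p -> koszul_homology M (powers n) p} :=
  homology_map (f' := koszul_trans m n p.+1) (f := koszul_trans m n p)
    (f0 := koszul_trans m n p.-1)
    (fun f => koszul_trans_diff p f nm)
    (fun f => koszul_trans_diff p.-1 f nm).

End KoszulPowers.

Section Localization.
Context (R : comPzRingType) (M : lmodType R) (x : R).

(* The pair (m, n) stands for the fraction m / x^n. *)
Definition frac_eqv (p q : M * nat) : Prop :=
  exists c, x ^+ c *: (x ^+ q.2 *: p.1) = x ^+ c *: (x ^+ p.2 *: q.1).

Definition frac_add (p q : M * nat) : M * nat :=
  (x ^+ q.2 *: p.1 + x ^+ p.2 *: q.1, (p.2 + q.2)%N).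

Definition frac_scale (a : R) (p : M * nat) : M * nat := (a *: p.1, p.2).

Let frac_eqv_eq p q : x ^+ q.2 *: p.1 = x ^+ p.2 *: q.1 -> frac_eqv p q.
Proof. by move=> pq; exists 0%N; rewrite pq. Qed.
Let frac_refl p : frac_eqv p p.
Proof. exact: frac_eqv_eq. Qed.
Let frac_sym p q : frac_eqv p q -> frac_eqv q p.
Proof. by case=> c pq; exists c. Qed.
Let frac_trans p q r : frac_eqv p q -> frac_eqv q r -> frac_eqv p r.
Proof.
case: p q r => [m a] [m' b] [m'' e] [c /= pq] [d /= qr].
exists (c + d + b)%N => /=; rewrite !scalerA -!exprD in pq qr *.
have -> : (c + d + b + e = (d + e) + (c + b))%N by lia.
have -> : (c + d + b + a = (c + a) + (d + b))%N by lia.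
rewrite exprD -scalerA pq scalerA -exprD (addnC (d + e)).
by rewrite exprD -scalerA qr scalerA -exprD.
Qed.
Let frac_addP p p' q q' : frac_eqv p p' -> frac_eqv q q' ->
  frac_eqv (frac_add p q) (frac_add p' q').
Proof.
case: p p' q q' => [m a] [m' a'] [n b] [n' b'] [c /= pp] [d /= qq].
exists (c + d)%N => /=; rewrite !scalerDr !scalerA -!exprD in pp qq *.
congr (_ + _).
  rewrite (_ : c + d + _ + _ = (d + b + b') + (c + a'))%N; last by lia.
  rewrite (_ : c + d + _ + _ = (d + b + b') + (c + a))%N; last by lia.
  by rewrite exprD -scalerA pp scalerA -exprD.
rewrite (_ : c + d + _ + _ = (c + a + a') + (d + b'))%N; last by lia.
rewrite (_ : c + d + _ + _ = (c + a + a') + (d + b))%N; last by lia.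
by rewrite exprD -scalerA qq scalerA -exprD.
Qed.
Let frac_scaleP a p p' : frac_eqv p p' ->
  frac_eqv (frac_scale a p) (frac_scale a p').
Proof.
case=> c pp; exists c.
have scaleC (b : nat) (m : M) :
    x ^+ c *: (x ^+ b *: (a *: m)) = a *: (x ^+ c *: (x ^+ b *: m)).
  by rewrite !scalerA; congr (_ *: _); ring.
by rewrite /= !scaleC pp.
Qed.
Let frac_addA p q r :
  frac_eqv (frac_add p (frac_add q r)) (frac_add (frac_add p q) r).
Proof.
apply: frac_eqv_eq; rewrite /= addnA; congr (_ *: _).
rewrite !scalerDr !scalerA -!exprD addrA.
by congr (_ *: _ + _ *: _ + _ *: _); congr (_ ^+ _); lia.
Qed.
Let frac_addC p q : frac_eqv (frac_add p q) (frac_add q p).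
Proof. by apply: frac_eqv_eq; rewrite /= addnC addrC. Qed.
Let frac_add0 p : frac_eqv (frac_add (0, 0%N) p) p.
Proof. by apply: frac_eqv_eq; rewrite /= scaler0 !add0r expr0 scale1r. Qed.
Let frac_scale0 p : frac_eqv (frac_scale 0 p) (0, 0%N).
Proof. by apply: frac_eqv_eq; rewrite /= scale0r !scaler0. Qed.
Let frac_scale1 p : frac_eqv (frac_scale 1 p) p.
Proof. by apply: frac_eqv_eq; rewrite /= scale1r. Qed.
Let frac_scaleA a b p :
  frac_eqv (frac_scale a (frac_scale b p)) (frac_scale (a * b) p).
Proof. by apply: frac_eqv_eq; rewrite /= -scalerA. Qed.
Let frac_scaleDr a p q : frac_eqv (frac_scale a (frac_add p q))
  (frac_add (frac_scale a p) (frac_scale a q)).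
Proof.
apply: frac_eqv_eq; congr (_ *: _); rewrite /= scalerDr !scalerA.
by rewrite ![a * _]mulrC.
Qed.
Let frac_scaleDl a b p : frac_eqv (frac_scale (a + b) p)
  (frac_add (frac_scale a p) (frac_scale b p)).
Proof.
by apply: frac_eqv_eq; rewrite /= -scalerDr -scalerDl [RHS]scalerA -exprD.
Qed.

Definition loc_premodule : premodule R := @Premodule R (M * nat)%type frac_eqv
  (0, 0%N) frac_add frac_scale frac_refl frac_sym frac_trans frac_addP
  frac_scaleP frac_addA frac_addC frac_add0 frac_scale0 frac_scale1 frac_scaleA
  frac_scaleDr frac_scaleDl.

Definition loc : lmodType R := quotient loc_premodule.

Definition frac (m : M) (n : nat) : loc := class ((m, n) : loc_premodule).

Lemma frac_eqP m n m' n' : frac m n = frac m' n' <->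
  exists c, x ^+ c *: (x ^+ n' *: m) = x ^+ c *: (x ^+ n *: m').
Proof. exact: (@class_eqP R loc_premodule (m, n) (m', n')). Qed.

Lemma frac_eq m n m' n' : x ^+ n' *: m = x ^+ n *: m' -> frac m n = frac m' n'.
Proof. by move=> mm; apply/frac_eqP; exists 0%N; rewrite mm. Qed.

Lemma fracD m n m' n' :
  frac m n + frac m' n' = frac (x ^+ n' *: m + x ^+ n *: m') (n + n').
Proof. by rewrite /frac -classD. Qed.

Lemma fracZ a m n : a *: frac m n = frac (a *: m) n.
Proof. by rewrite /frac -classZ. Qed.

Lemma frac_linear a m m' n : frac (a *: m + m') n = a *: frac m n + frac m' n.
Proof.
rewrite fracZ fracD; apply: frac_eq.
by rewrite -scalerDr scalerA -exprD.
Qed.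

Lemma loc_ind (Q : loc -> Prop) : (forall m n, Q (frac m n)) -> forall u, Q u.
Proof. by move=> Qf; apply: quotient_ind => -[m n]; exact: Qf. Qed.

End Localization.

Section LocalizationMap.
Context (R : comPzRingType) (M : lmodType R) (x y : R) (l : nat) (r : R).
Context (xyr : x ^+ l = y * r).

Let alpha_fun (p : loc_premodule M y) : loc M x :=
  frac x (r ^+ p.2 *: p.1) (l * p.2).

Let alpha_compat p q : pm_eqv p q -> alpha_fun p = alpha_fun q.
Proof.
case: p q => [m a] [m' b] [c /= mm]; apply/frac_eqP; exists (l * c)%N.
rewrite /= !exprM !xyr !exprMn !scalerA in mm *.
rewrite (_ : _ * _ = r ^+ (a + b + c) * (y ^+ c * y ^+ b)); last first.
  by rewrite !exprD; ring.
rewrite -scalerA mm scalerA; congr (_ *: _); rewrite !exprD; ring.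
Qed.

Let alpha_linear a p q : alpha_fun (pm_add (pm_scale a p) q) =
  a *: alpha_fun p + alpha_fun q.
Proof.
case: p q => [m b] [m' c]; rewrite /alpha_fun /= fracZ fracD -mulnDr.
congr (frac _ _ _); rewrite !exprM !xyr scalerDr !scalerA !exprMn.
by congr (_ *: _ + _ *: _); rewrite exprD; ring.
Qed.

(* the map M_y -> M_x, m / y^n |-> r^n m / x^(l n), for x^l = y r *)
Definition alpha : {linear loc M y -> loc M x} := lift alpha_compat alpha_linear.

Lemma alphaE m n : alpha (frac y m n) = frac x (r ^+ n *: m) (l * n).
Proof. exact: liftE. Qed.

End LocalizationMap.

Arguments alpha {R M x y l r} xyr.

Lemma alpha_indep (R : comPzRingType) (M : lmodType R) (x y : R) l r l' r'
    (h : x ^+ l = y * r) (h' : x ^+ l' = y * r') (u : loc M y) :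
  alpha h u = alpha h' u.
Proof.
elim/loc_ind: u => m n; rewrite !alphaE; apply/frac_eqP.
exists 0%N; rewrite !exprM !h !h' !scalerA !exprMn; congr (_ *: _); ring.
Qed.

Section Ideals.
Context (R : comPzRingType).

Definition ideal_pred (S : R -> Prop) : {pred R^o} :=
  fun a => `[< exists (n : nat) (c s : 'I_n -> R),
    (forall i, S (s i)) /\ a = \sum_i c i * s i >].

Lemma ideal_pred_closed S : submod_closed (ideal_pred S).
Proof.
split=> [|a u v].
  apply/asboolP; exists 0%N, (fun=> 0), (fun=> 0); rewrite big_ord0.
  by split=> // -[].
move=> /asboolP[n1 [c1 [s1 [S1 ->]]]] /asboolP[n2 [c2 [s2 [S2 ->]]]].
apply/asboolP; exists (n1 + n2)%N.
exists (fun i => match split i with inl j => a * c1 j | inr j => c2 j end).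
exists (fun i => match split i with inl j => s1 j | inr j => s2 j end).
split=> [i|]; first by case: (split i).
rewrite big_split_ord /= scaler_sumr; congr (_ + _); apply: eq_bigr => i _.
  by rewrite (unsplitK (inl i)) -mulrA.
by rewrite (unsplitK (inr i)).
Qed.

HB.instance Definition _ S :=
  GRing.isSubmodClosed.Build R R^o (ideal_pred S) (ideal_pred_closed S).

Lemma ideal_pred_gen (S : R -> Prop) a : S a -> a \in ideal_pred S.
Proof.
move=> Sa; apply/asboolP; exists 1%N, (fun=> 1), (fun=> a).
by rewrite big_ord1 mul1r.
Qed.

Lemma ideal_pred_sub (S T : R -> Prop) :
  (forall a, S a -> a \in ideal_pred T) ->
  forall a, a \in ideal_pred S -> a \in ideal_pred T.
Proof.
move=> ST a /asboolP[n [c [s [Ss ->]]]]; apply: rpred_sum => i _.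
by apply: (rpredZ (c i)); exact: ST.
Qed.

Record ideal (S : R -> Prop) := Ideal {
  ideal_val : R^o;
  _ : ideal_val \in ideal_pred S
}.

HB.instance Definition _ S := [isSub for @ideal_val S].
HB.instance Definition _ S := [Choice of ideal S by <:].
HB.instance Definition _ S := [SubChoice_isSubLmodule of ideal S by <:].

Definition elt (S : R -> Prop) (a : ideal S) : R := ideal_val a.

Lemma eltP (S : R -> Prop) (a : ideal S) : elt a \in ideal_pred S.
Proof. by case: a. Qed.

Lemma elt_inj (S : R -> Prop) : injective (@elt S).
Proof. exact: val_inj. Qed.

(* generators of the n-th power of the ideal generated by S *)
Definition ideal_products (S : R -> Prop) (n : nat) : R -> Prop := fun a =>
  exists t : 'I_n -> R, (forall i, t i \in ideal_pred S) /\ a = \prod_i t i.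

Definition ideal_power (S : R -> Prop) (n : nat) : lmodType R :=
  ideal (ideal_products S n).

Context (S : R -> Prop).

Lemma ideal_power_sub n p : (n <= p)%N -> forall a,
  a \in ideal_pred (ideal_products S p) -> a \in ideal_pred (ideal_products S n).
Proof.
move=> np; apply: ideal_pred_sub => _ [t [tS ->]].
rewrite (bigID (fun i : 'I_p => (i < n)%N)) /= mulrC.
apply: (@rpredZ _ R^o); apply: ideal_pred_gen.
by exists (fun i => t (widen_ord np i)); split => //; rewrite big_ord_narrow.
Qed.

Section Inclusion.
Context (n p : nat) (np : (n <= p)%N).

Let incl_subproof (a : ideal_power S p) :
  ideal_val a \in ideal_pred (ideal_products S n).
Proof. by apply: (ideal_power_sub np); case: a. Qed.

Definition incl_fun (a : ideal_power S p) : ideal_power S n :=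
  Ideal (incl_subproof a).

Let incl_linear : linear incl_fun.
Proof. by move=> c a b; apply: val_inj; rewrite -[LHS]/(val (c *: a + b)) linearP. Qed.

HB.instance Definition _ := GRing.isLinear.Build R (ideal_power S p)
  (ideal_power S n) *:%R incl_fun incl_linear.

Definition incl : {linear ideal_power S p -> ideal_power S n} := incl_fun.

Lemma incl_elt a : elt (incl a) = elt a. Proof. by []. Qed.

End Inclusion.

Let exp_subproof (a : ideal S) n :
  elt a ^+ n \in ideal_pred (ideal_products S n).
Proof.
apply: ideal_pred_gen; exists (fun=> elt a); split=> [_|]; first exact: eltP.
by rewrite prodr_const card_ord.
Qed.

Definition ideal_exp (a : ideal S) n : ideal_power S n :=
  Ideal (exp_subproof a n).

End Ideals.

Section Transform.
Context (R : comPzRingType) (S : R -> Prop) (M : lmodType R).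

Local Notation Jn := (ideal_power S).

Definition restrict n p (np : (n <= p)%N) (f : {linear Jn n -> M}) :
  {linear Jn p -> M} := f \o incl S np.

Lemma restrictE n p (np : (n <= p)%N) f a : restrict np f a = f (incl S np a).
Proof. by []. Qed.

Lemma restrictD n p (np : (n <= p)%N) f g :
  restrict np (f + g) = restrict np f + restrict np g.
Proof. exact: hom_ext. Qed.

Lemma restrictZ n p (np : (n <= p)%N) a f :
  restrict np (a *: f) = a *: restrict np f.
Proof. exact: hom_ext. Qed.

Lemma restrict_trans n p q (np : (n <= p)%N) (pq : (p <= q)%N) (nq : (n <= q)%N)
  f : restrict pq (restrict np f) = restrict nq f.
Proof. by apply: hom_ext => a; rewrite /=; congr (f _); exact: val_inj. Qed.

Lemma restrict_id n (nn : (n <= n)%N) f : restrict nn f = f.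
Proof. by apply: hom_ext => a; rewrite /=; congr (f _); exact: val_inj. Qed.

(* The pair (n, f) stands for the class of f : J^n -> M in the direct limit. *)
Definition germ_type : Type := {n : nat & {linear Jn n -> M}}.
HB.instance Definition _ := Choice.on germ_type.

Definition germ (n : nat) (f : {linear Jn n -> M}) : germ_type :=
  Tagged (fun n => {linear Jn n -> M}) f.

Definition germ_eqv (p q : germ_type) : Prop :=
  exists N (hp : (tag p <= N)%N) (hq : (tag q <= N)%N),
    restrict hp (tagged p) = restrict hq (tagged q).

Definition germ_add (p q : germ_type) : germ_type :=
  germ (restrict (leq_addr (tag q) (tag p)) (tagged p) +
        restrict (leq_addl (tag p) (tag q)) (tagged q)).

Definition germ_scale (a : R) (p : germ_type) : germ_type :=
  germ (a *: tagged p).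

Let germ_refl p : germ_eqv p p.
Proof. by exists (tag p), (leqnn _), (leqnn _). Qed.
Let germ_sym p q : germ_eqv p q -> germ_eqv q p.
Proof. by case=> N [hp [hq pq]]; exists N, hq, hp. Qed.

Let restrict_le n m (f : {linear Jn n -> M}) (g : {linear Jn m -> M}) p q
    (np : (n <= p)%N) (mp : (m <= p)%N) (nq : (n <= q)%N) (mq : (m <= q)%N) :
  (p <= q)%N -> restrict np f = restrict mp g -> restrict nq f = restrict mq g.
Proof.
move=> pq fg; rewrite -(restrict_trans np pq nq) fg.
exact: restrict_trans.
Qed.

Let germ_trans p q r : germ_eqv p q -> germ_eqv q r -> germ_eqv p r.
Proof.
case=> N [hp [hq pq]] [N' [hq' [hr qr]]].
have hp2 : (tag p <= N + N')%N by lia.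
have hq2 : (tag q <= N + N')%N by lia.
have hr2 : (tag r <= N + N')%N by lia.
exists (N + N')%N, hp2, hr2.
rewrite (restrict_le hp2 hq2 (leq_addr _ _) pq).
exact: (restrict_le hq2 hr2 (leq_addl _ _) qr).
Qed.
Let germ_addP p p' q q' : germ_eqv p p' -> germ_eqv q q' ->
  germ_eqv (germ_add p q) (germ_add p' q').
Proof.
case: p p' q q' => [n f] [n' f'] [m g] [m' g'].
case=> N [/= hp [hp' ff]] [N' [/= hq [hq' gg]]].
have h1 : (n + m <= N + N')%N by lia.
have h2 : (n' + m' <= N + N')%N by lia.
exists (N + N')%N, h1, h2.
rewrite /= !restrictD; congr (_ + _).
  have hn : (n <= N + N')%N by lia.
  have hn' : (n' <= N + N')%N by lia.
  rewrite (restrict_trans _ h1 hn) (restrict_trans _ h2 hn').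
  exact: (restrict_le hn hn' (leq_addr _ _) ff).
have hn : (m <= N + N')%N by lia.
have hn' : (m' <= N + N')%N by lia.
rewrite (restrict_trans _ h1 hn) (restrict_trans _ h2 hn').
exact: (restrict_le hn hn' (leq_addl _ _) gg).
Qed.
Let germ_scaleP a p p' : germ_eqv p p' ->
  germ_eqv (germ_scale a p) (germ_scale a p').
Proof.
case=> N [hp [hp' pp]]; exists N, hp, hp'.
by rewrite /= !restrictZ pp.
Qed.
Let germ_addA p q r :
  germ_eqv (germ_add p (germ_add q r)) (germ_add (germ_add p q) r).
Proof.
case: p q r => [n f] [m g] [p h].
have h1 : (n + (m + p) <= n + m + p)%N by lia.
exists (n + m + p)%N, h1, (leqnn _).
apply: hom_ext => a; rewrite /= addrA.
by congr (f _ + g _ + h _); apply: val_inj.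
Qed.
Let germ_addC p q : germ_eqv (germ_add p q) (germ_add q p).
Proof.
case: p q => [n f] [m g].
have h1 : (m + n <= n + m)%N by lia.
exists (n + m)%N, (leqnn _), h1.
apply: hom_ext => a; rewrite /= addrC.
by congr (g _ + f _); apply: val_inj.
Qed.
Let germ_add0 p : germ_eqv (germ_add (germ (0 : {linear Jn 0 -> M})) p) p.
Proof.
case: p => [n f]; exists n, (leqnn _), (leqnn _).
apply: hom_ext => a; rewrite /= add0r.
by congr (f _); apply: val_inj.
Qed.
Let germ_scale0 p : germ_eqv (germ_scale 0 p) (germ (0 : {linear Jn 0 -> M})).
Proof.
case: p => [n f]; exists n, (leqnn _), (leq0n _).
by apply: hom_ext => a; rewrite /= scale0r.
Qed.
Let germ_scale1 p : germ_eqv (germ_scale 1 p) p.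
Proof.
exists (tag p), (leqnn _), (leqnn _).
by apply: hom_ext => a; rewrite /= scale1r.
Qed.
Let germ_scaleA a b p :
  germ_eqv (germ_scale a (germ_scale b p)) (germ_scale (a * b) p).
Proof.
exists (tag p), (leqnn _), (leqnn _).
by apply: hom_ext => c; rewrite /= scalerA.
Qed.
Let germ_scaleDr a p q : germ_eqv (germ_scale a (germ_add p q))
  (germ_add (germ_scale a p) (germ_scale a q)).
Proof.
exists (tag p + tag q)%N, (leqnn _), (leqnn _).
by apply: hom_ext => c; rewrite /= scalerDr.
Qed.
Let germ_scaleDl a b p : germ_eqv (germ_scale (a + b) p)
  (germ_add (germ_scale a p) (germ_scale b p)).
Proof.
exists (tag p + tag p)%N, (leq_addr _ _), (leqnn _).
apply: hom_ext => c; rewrite /= scalerDl.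
by congr (_ *: tagged p _ + _ *: tagged p _); apply: val_inj.
Qed.

Definition transform_premodule : premodule R := @Premodule R germ_type germ_eqv
  (germ (0 : {linear Jn 0 -> M})) germ_add germ_scale germ_refl germ_sym
  germ_trans germ_addP germ_scaleP germ_addA germ_addC germ_add0 germ_scale0
  germ_scale1 germ_scaleA germ_scaleDr germ_scaleDl.

Definition transform : lmodType R := quotient transform_premodule.

Definition transform_class n (f : {linear Jn n -> M}) : transform :=
  class (germ f : transform_premodule).

Lemma transform_class_eqP n p (f : {linear Jn n -> M}) (g : {linear Jn p -> M}) :
  transform_class f = transform_class g <->
  exists N (hn : (n <= N)%N) (hp : (p <= N)%N), restrict hn f = restrict hp g.
Proof. exact: (@class_eqP R transform_premodule (germ f) (germ g)). Qed.

Lemma transform_ind (Q : transform -> Prop) :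
  (forall n (f : {linear Jn n -> M}), Q (transform_class f)) -> forall u, Q u.
Proof. by move=> Qf; apply: quotient_ind => -[n f]; exact: Qf. Qed.

End Transform.

Section Limit.
Context (R : comPzRingType) (S : R -> Prop) (M : lmodType R).

Local Notation J := (ideal S).

Definition loc_family : lmodType R :=
  family (fun a : J => loc M (elt a)).

Definition loc_compatible (f : loc_family) : Prop :=
  forall (x y : J) (l : nat) (r : R)
    (xyr : elt x ^+ l = elt y * r),
  (0 < l)%N -> alpha xyr (f y) = f x.

Definition loc_compatible_pred : {pred loc_family} :=
  fun f => `[< loc_compatible f >].

Let loc_compatible_closed : submod_closed loc_compatible_pred.
Proof.
split=> [|a f g /asboolP cf /asboolP cg]; apply/asboolP=> x y l r xyr l0.
  by rewrite family0 linear0.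
by rewrite familyD familyZ linearP cf // cg.
Qed.

HB.instance Definition _ := GRing.isSubmodClosed.Build R loc_family
  loc_compatible_pred loc_compatible_closed.

Record loc_limit_type : Type := LocLimit {
  loc_limit_val : loc_family;
  _ : loc_limit_val \in loc_compatible_pred
}.

HB.instance Definition _ := [isSub for loc_limit_val].
HB.instance Definition _ := [Choice of loc_limit_type by <:].
HB.instance Definition _ := [SubChoice_isSubLmodule of loc_limit_type by <:].

Definition loc_limit : lmodType R := loc_limit_type.

Definition loc_proj (a : J) (f : loc_limit) : loc M (elt a) :=
  loc_limit_val f a.

Lemma loc_proj_compat (f : loc_limit) (x y : J) l r
    (xyr : elt x ^+ l = elt y * r) : (0 < l)%N ->
  alpha xyr (loc_proj y f) = loc_proj x f.
Proof. by case: f => f /= /asboolP; apply. Qed.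

End Limit.

(* Only degrees 0, 1 and 2 of the Cech complex enter ker d^1 and
   H^1 = ker d^1 / im d^0. *)

Section Cech.
Context (R : comPzRingType) (k : nat) (x : 'I_k -> R) (M : lmodType R).

Definition index_pair : Type := {p : 'I_k * 'I_k | (p.1 < p.2)%N}.

Definition cech1 : lmodType R := family (fun i : 'I_k => loc M (x i)).

Definition cech2 : lmodType R :=
  family (fun p : index_pair => loc M (x (val p).1 * x (val p).2)).

Definition to_mulr (y z : R) : {linear loc M y -> loc M (y * z)} :=
  alpha (expr1 (y * z)).

Definition to_mull (y z : R) : {linear loc M z -> loc M (y * z)} :=
  alpha (etrans (expr1 (y * z)) (mulrC y z)).

Lemma to_mulrE y z m n : to_mulr y z (frac y m n) = frac (y * z) (z ^+ n *: m) n.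
Proof. by rewrite /to_mulr alphaE mul1n. Qed.

Lemma to_mullE y z m n : to_mull y z (frac z m n) = frac (y * z) (y ^+ n *: m) n.
Proof. by rewrite /to_mull alphaE mul1n. Qed.

Definition cech_d0_fun (m : M) : cech1 := fun i => frac (x i) m 0.

Let cech_d0_linear : linear cech_d0_fun.
Proof.
by move=> a m m'; apply: functional_extensionality_dep => i; exact: frac_linear.
Qed.

HB.instance Definition _ :=
  GRing.isLinear.Build R M cech1 *:%R cech_d0_fun cech_d0_linear.

Definition cech_d0 : {linear M -> cech1} := cech_d0_fun.

Definition cech_d1_fun (f : cech1) : cech2 := fun p =>
  to_mull (x (val p).1) (x (val p).2) (f (val p).2) -
  to_mulr (x (val p).1) (x (val p).2) (f (val p).1).

Let cech_d1_linear : linear cech_d1_fun.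
Proof.
move=> a f g; apply: functional_extensionality_dep => p.
rewrite familyD familyZ /cech_d1_fun !familyD !familyZ !linearP.
by rewrite scalerDr addrACA.
Qed.

HB.instance Definition _ :=
  GRing.isLinear.Build R cech1 cech2 *:%R cech_d1_fun cech_d1_linear.

Definition cech_d1 : {linear cech1 -> cech2} := cech_d1_fun.

Lemma cech_d1_d0 m : cech_d1 (cech_d0 m) = 0.
Proof.
apply: functional_extensionality_dep => p.
rewrite -[LHS]/(to_mull _ _ (frac _ m 0) - to_mulr _ _ (frac _ m 0)).
by rewrite to_mullE to_mulrE !expr0 subrr.
Qed.

Definition cech_D0 : lmodType R := kernel cech_d1.

Definition cech_H1 : lmodType R := homology cech_d0 cech_d1.

End Cech.

Arguments to_mulr {R M} y z.
Arguments to_mull {R M} y z.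

Section Maps.
Context (R : comPzRingType) (k : nat) (x : 'I_k -> R) (M : lmodType R).

Definition gens : R -> Prop := fun a => exists i, a = x i.

Definition gen (i : 'I_k) : ideal gens :=
  @Ideal R gens (x i) (ideal_pred_gen (ex_intro _ i erefl)).

Definition D_J : lmodType R := transform gens M.

Definition lim_J : lmodType R := loc_limit gens M.

(* the family (phi(a^n) / a^n)_(a in J) of phi : J^n -> M *)
Definition theta_germ (p : germ_type gens M) : loc_family gens M :=
  fun a => frac (elt a) (tagged p (ideal_exp a (tag p))) (tag p).

(* the family (phi(x_i^n) / x_i^n)_(i < k) of phi : J^n -> M *)
Definition rho_germ (p : germ_type gens M) : cech1 x M :=
  fun i => frac (x i) (tagged p (ideal_exp (gen i) (tag p))) (tag p).

Let frac_restrict n p (np : (n <= p)%N) (f : {linear ideal_power gens n -> M}) a :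
  frac (elt a) (restrict np f (ideal_exp a p)) p =
  frac (elt a) (f (ideal_exp a n)) n.
Proof.
apply: frac_eq; rewrite restrictE -!linearZ; congr (f _); apply: val_inj.
exact: mulrC.
Qed.

Let frac_germ_compat (p q : germ_type gens M) a : germ_eqv p q ->
  frac (elt a) (tagged p (ideal_exp a (tag p))) (tag p) =
  frac (elt a) (tagged q (ideal_exp a (tag q))) (tag q).
Proof.
case=> N [hp [hq pq]].
by rewrite -(frac_restrict hp) -(frac_restrict hq) pq.
Qed.

Let frac_germ_linear c (p q : germ_type gens M) a :
  let r := germ_add (germ_scale c p) q in
  frac (elt a) (tagged r (ideal_exp a (tag r))) (tag r) =
  c *: frac (elt a) (tagged p (ideal_exp a (tag p))) (tag p) +
  frac (elt a) (tagged q (ideal_exp a (tag q))) (tag q).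
Proof.
move=> r; rewrite /r /germ_add /germ_scale /= frac_linear.
by congr (_ *: _ + _); exact: frac_restrict.
Qed.

Let theta_germ_compatible p : theta_germ p \in @loc_compatible_pred R gens M.
Proof.
apply/asboolP=> a b l r abr l0; rewrite /theta_germ alphaE; apply: frac_eq.
rewrite scalerA -!linearZ; congr (tagged p _); apply: elt_inj.
rewrite -[LHS]/(elt a ^+ tag p * r ^+ tag p * elt b ^+ tag p).
rewrite -[RHS]/(elt a ^+ (l * tag p) * elt a ^+ tag p).
by rewrite exprM abr exprMn; ring.
Qed.

Let theta_fun (p : transform_premodule gens M) : lim_J :=
  LocLimit (theta_germ_compatible p).

Let theta_fun_compat p q : pm_eqv p q -> theta_fun p = theta_fun q.
Proof.
move=> pq; apply: val_inj; apply: functional_extensionality_dep => a.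
exact: frac_germ_compat.
Qed.

Let theta_fun_linear c p q : theta_fun (pm_add (pm_scale c p) q) =
  c *: theta_fun p + theta_fun q.
Proof.
apply: val_inj; rewrite linearP; apply: functional_extensionality_dep => a.
exact: frac_germ_linear.
Qed.

Definition theta : {linear D_J -> lim_J} := lift theta_fun_compat theta_fun_linear.

Lemma thetaE n (f : {linear ideal_power gens n -> M}) a :
  loc_proj a (theta (transform_class f)) =
  frac (elt a) (f (ideal_exp a n)) n.
Proof. by rewrite /theta /transform_class liftE. Qed.

Let rho_germ_ker p : rho_germ p \in ker (cech_d1 x M).
Proof.
rewrite inE; apply/eqP; apply: functional_extensionality_dep => -[[i j] ij].
rewrite -[LHS]/(to_mull (x i) (x j) (rho_germ p j) -
  to_mulr (x i) (x j) (rho_germ p i)).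
apply/eqP; rewrite subr_eq0; apply/eqP.
rewrite /rho_germ to_mullE to_mulrE -!linearZ.
by congr (frac _ (tagged p _) _); apply: elt_inj; exact: mulrC.
Qed.

Let rho_fun (p : transform_premodule gens M) : cech_D0 x M :=
  Kernel (rho_germ_ker p).

Let rho_fun_compat p q : pm_eqv p q -> rho_fun p = rho_fun q.
Proof.
move=> pq; apply: val_inj; apply: functional_extensionality_dep => i.
exact: (frac_germ_compat (gen i)).
Qed.

Let rho_fun_linear c p q : rho_fun (pm_add (pm_scale c p) q) =
  c *: rho_fun p + rho_fun q.
Proof.
apply: val_inj; rewrite linearP; apply: functional_extensionality_dep => i.
exact: (frac_germ_linear _ _ _ (gen i)).
Qed.

Definition rho : {linear D_J -> cech_D0 x M} := lift rho_fun_compat rho_fun_linear.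

Lemma rhoE n (f : {linear ideal_power gens n -> M}) i :
  kernel_val (rho (transform_class f)) i =
  frac (x i) (f (ideal_exp (gen i) n)) n.
Proof. by rewrite /rho /transform_class liftE. Qed.

Definition sigma_family (f : lim_J) : cech1 x M := fun i => loc_proj (gen i) f.

Let sigma_family_ker f : sigma_family f \in ker (cech_d1 x M).
Proof.
rewrite inE; apply/eqP; apply: functional_extensionality_dep => -[[i j] ij].
apply/eqP; rewrite -[X in X == _]/(to_mull (x i) (x j) (sigma_family f j) -
  to_mulr (x i) (x j) (sigma_family f i)) subr_eq0; apply/eqP.
rewrite /to_mull /to_mulr /sigma_family.
pose a : ideal gens := x i *: gen j.
have h1 : elt a ^+ 1 = elt (gen i) * x j by exact: expr1.
have h2 : elt a ^+ 1 = elt (gen j) * x i.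
  by rewrite expr1 mulrC.
rewrite (alpha_indep _ h1) (alpha_indep _ h2).
by rewrite (loc_proj_compat f h1) // (loc_proj_compat f h2).
Qed.

Definition sigma_fun (f : lim_J) : cech_D0 x M := Kernel (sigma_family_ker f).

Let sigma_linear : linear sigma_fun.
Proof.
move=> c f g; apply: val_inj; rewrite linearP.
by apply: functional_extensionality_dep => i.
Qed.

HB.instance Definition _ :=
  GRing.isLinear.Build R lim_J (cech_D0 x M) *:%R sigma_fun sigma_linear.

Definition sigma : {linear lim_J -> cech_D0 x M} := sigma_fun.

Lemma sigmaE f i : kernel_val (sigma f) i = loc_proj (gen i) f.
Proof. by []. Qed.

End Maps.

Definition koszul_pro_zero (R : comPzRingType) (k : nat) (x : 'I_k -> R)
    (M : lmodType R) (p : nat) : Prop :=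
  forall n, (0 < n)%N -> exists (m : nat) (nm : (n <= m)%N),
    forall u, koszul_map x M nm p u = 0.

(* Main.v *)
From HB Require Import structures.
From mathcomp Require Import all_boot all_algebra.
From mathcomp Require Import boolp zify ring.
Require Import Defs.

Set Implicit Arguments.
Unset Strict Implicit.
Unset Printing Implicit Defensive.

Import GRing.Theory.
Local Open Scope ring_scope.

(** Everything rests on the inclusion of J^N in (x_1^m, ..., x_k^m) for
    N > k m ([ideal_power_sub_powers]): a condition at the generators alone
    spreads to all of J, and to homomorphisms out of J^N.

    After clearing denominators, a cocycle in ker d^1 is (m_i / x_i^n)_i with
    x_j^n m_i = x_i^n m_j in M itself ([cech_D0_compatible]). For a in J with
    a^N = \sum_i b_i x_i^n the fraction (\sum_i b_i m_i) / a^N restricts to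
    this cocycle, and it is the only fraction w / a^N' with
    x_i^n w = a^N' m_i for all i. Uniqueness makes these fractions compatible
    with the maps alpha, whence the inverse of sigma ([sigma_surj]). As sigma is
    bijective and rho = sigma \o theta, all questions about theta are questions
    about rho. Also rho is injective, because a map on J^n that kills the
    x_i^(c + n) vanishes on J^N for large N ([rho_inj]). What remains is to
    decide when rho is surjective.

    For (2), the kernel and the cokernel of the canonical map tau : M -> D_J(M)
    consist of elements killed by powers of each a in J, since
    a^n [f] = tau (f (a^n)) for f : J^n -> M. Hence tau becomes an isomorphism
    after localizing at a. It identifies ker d^1 for M with ker d^1 for D_J(M),
    and it turns rho into d^0 : D_J(M) -> ker d^1 ([loc_tau_rho]), so that the
    cokernel of rho is the first Cech cohomology of D_J(M).

    For (3), a compatible family (m_i) in M is a map from the cokernel of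
    K_2(x^(n)) -> K_1(x^(n)), which is generated by the e_i subject to
    x_j^n e_i = x_i^n e_j. The cocycle comes from a map on some J^N iff
    x_i^p |-> x_i^(p - n) m_i extends to the ideal (x_1^p, ..., x_k^p) for some
    p, i.e. iff \sum_i b_i x_i^p = 0 implies \sum_i b_i x_i^(p - n) m_i = 0.
    The vanishing of H_1(x^(p); R) -> H_1(x^(n); R) says exactly this for the
    universal family e_i, hence implies it for every family
    ([rho_surj_of_pro_zero]). Conversely, surjectivity of rho for the cokernel
    itself yields such a p ([pro_zero_of_rho_surj]). *)

(** * Finite bounds and skew-symmetric sums *)

Lemma inj_surj_bijective (A B : Type) (f : A -> B) :
  injective f -> (forall b, exists a, f a = b) -> bijective f.
Proof.
move=> f_inj f_surj; have [g gK] := choice f_surj.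
by exists g => // a; apply: f_inj; rewrite gK.
Qed.

Lemma uniform_bound (I : finType) (P : I -> nat -> Prop) :
  (forall i c c', (c <= c')%N -> P i c -> P i c') ->
  (forall i, exists c, P i c) -> exists c, forall i, P i c.
Proof.
move=> Pmono /fin_all_exists[c Pc]; exists (\max_i c i)%N => i.
exact: Pmono (leq_bigmax i) (Pc i).
Qed.

(** The terms at (i, j) and (j, i) cancel. They are paired explicitly, since
    exchanging the two sums would only show that twice the sum is zero. *)
Lemma sum_skew (V : zmodType) (n : nat) (a : 'I_n -> 'I_n -> V) :
  (forall i j, i != j -> a i j = - a j i) ->
  \sum_i \sum_(j | j != i) a i j = 0.
Proof.
move=> aC.
rewrite (eq_bigr (fun i : 'I_n => \sum_(j : 'I_n | (j < i)%N) a i j +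
  \sum_(j : 'I_n | (i < j)%N) a i j)).
  rewrite big_split /= [X in _ + X](exchange_big_dep xpredT) //= -big_split /=.
  apply: big1 => i _; rewrite -big_split /=; apply: big1 => j ji.
  by rewrite (aC i j) ?addNr // neq_ltn ji orbT.
move=> i _; rewrite (bigID (fun j : 'I_n => (j < i)%N)) /=.
by congr (_ + _); apply: eq_bigl => j; rewrite -val_eqE /=; case: ltngtP.
Qed.

(** * Powers of an ideal and powers of its generators *)

Section IdealPowers.
Context (R : comPzRingType) (k : nat).

Lemma mem_gensP (y : 'I_k -> R) (a : R) :
  a \in ideal_pred (gens y) <-> exists b : 'I_k -> R, a = \sum_i b i * y i.
Proof.
split=> [/asboolP[n [c [s [/fin_all_exists[p sE] ->]]]]|[b ->]].
  exists (fun i => \sum_(t | p t == i) c t).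
  rewrite (partition_big p xpredT) //=; apply: eq_bigr => i _.
  by rewrite mulr_suml; apply: eq_bigr => t /eqP pt; rewrite sE pt.
apply: rpred_sum => i _; apply: (@rpredZ _ R^o).
by apply: ideal_pred_gen; exists i.
Qed.

Context (x : 'I_k -> R).

(** The bound k m < N instead of k (m - 1) < N avoids truncated subtraction, and
    it covers k = 0, where N > 0 is needed. *)
Lemma pigeonhole (m N : nat) (f : 'I_N -> 'I_k) : (k * m < N)%N ->
  exists i, (m <= #|[pred s | f s == i]|)%N.
Proof.
move=> kmN; apply/existsP; apply: contraLR kmN; rewrite negb_exists -leqNgt.
move=> /forallP fm; rewrite -[X in (X <= _)%N]card_ord -sum1_card.
rewrite (partition_big f xpredT) //= -[k in (k * m)%N]card_ord -sum_nat_const.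
apply: leq_sum => i _; rewrite sum1_card.
by have := fm i; rewrite -ltnNge => /ltnW.
Qed.

(** Expanding a product of N linear combinations of the x_i gives monomials of
    degree N, and by the pigeonhole principle some x_i occurs m times in each. *)
Lemma ideal_power_sub_powers (m N : nat) (a : R) : (k * m < N)%N ->
  a \in ideal_pred (ideal_products (gens x) N) ->
  a \in ideal_pred (gens (powers x m)).
Proof.
move=> kmN; apply: ideal_pred_sub => _ [t [tS ->]].
have /fin_all_exists[b tE] s := (mem_gensP x (t s)).1 (tS s).
rewrite (eq_bigr _ (fun s _ => tE s)) bigA_distr_bigA /=.
apply: rpred_sum => f _; have [i mi] := pigeonhole f kmN.
have -> : \prod_s (b s (f s) * x (f s)) = \prod_s b s (f s) *
    (\prod_(s | f s != i) x (f s)) * x i ^+ (#|[pred s | f s == i]| - m) *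
    x i ^+ m.
  rewrite -mulrA -exprD subnK // -prodr_const big_split /= -mulrA; congr (_ * _).
  rewrite (bigID (fun s => f s == i)) /= mulrC; congr (_ * _).
  by apply: eq_bigr => s /eqP->.
apply: (@rpredZ _ R^o).
by apply: ideal_pred_gen; exists i.
Qed.

Lemma gens_exp_sum (a : ideal (gens x)) (m N : nat) : (k * m < N)%N ->
  exists b : 'I_k -> R, elt a ^+ N = \sum_i b i * x i ^+ m.
Proof.
move=> kmN; apply/(mem_gensP (powers x m))/(ideal_power_sub_powers kmN).
exact: eltP (ideal_exp a N).
Qed.

Lemma gens_torsion (M : lmodType R) (a : ideal (gens x)) (m N : nat) (v : M) :
  (k * m < N)%N -> (forall i, x i ^+ m *: v = 0) -> elt a ^+ N *: v = 0.
Proof.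
move=> kmN xv; have [b ->] := gens_exp_sum a kmN.
by rewrite scaler_suml big1 // => i _; rewrite -scalerA xv scaler0.
Qed.

End IdealPowers.

(** * Cocycles of degree one, and the bijection sigma *)

Section CechCocycles.
Context (R : comPzRingType) (k : nat) (x : 'I_k -> R) (M : lmodType R).

Lemma cech_kerP (z : cech1 x M) :
  reflect (forall i j : 'I_k, (i < j)%N ->
    to_mull (x i) (x j) (z j) = to_mulr (x i) (x j) (z i))
  (z \in ker (cech_d1 x M)).
Proof.
rewrite inE; apply: (iffP eqP) => [dz i j ij|zC].
  apply/eqP; rewrite -subr_eq0; apply/eqP.
  exact: (congr1 (@^~ (exist _ (i, j) ij)) dz).
apply: functional_extensionality_dep => -[[i j] ij].
by apply/eqP; rewrite subr_eq0; apply/eqP; exact: zC.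
Qed.

Definition compatible (n : nat) (m : 'I_k -> M) : Prop :=
  forall i j, x j ^+ n *: m i = x i ^+ n *: m j.

Lemma compatible_ker n (m : 'I_k -> M) :
  (forall i j : 'I_k, (i < j)%N -> x j ^+ n *: m i = x i ^+ n *: m j) ->
  ((fun i => frac (x i) (m i) n) : cech1 x M) \in ker (cech_d1 x M).
Proof.
by move=> mC; apply/cech_kerP => i j ij; rewrite to_mullE to_mulrE (mC i j).
Qed.

(** The cocycle condition in M_(x_i x_j) holds in M after multiplication by a
    power of x_i x_j. There are finitely many pairs, so a common power c works,
    and x_i^c can be absorbed into the numerators. The positivity of n is what
    the pro-zero condition asks of its index. *)
Lemma cech_D0_compatible (z : cech_D0 x M) : exists (n : nat) (m : 'I_k -> M),
  [/\ (0 < n)%N, compatible n m & forall i, kernel_val z i = frac (x i) (m i) n].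
Proof.
case: z => z /= /cech_kerP zC.
have /fin_all_exists[p zE] i : exists p : M * nat, z i = frac (x i) p.1 p.2.
  by elim/loc_ind: (z i) => m n; exists (m, n).
pose n := (\max_i (p i).2)%N.
have [m {}zE] : exists m : 'I_k -> M, forall i, z i = frac (x i) (m i) n.
  exists (fun i => x i ^+ (n - (p i).2) *: (p i).1) => i.
  rewrite zE; apply: frac_eq; rewrite scalerA -exprD subnKC //.
  exact: (leq_bigmax i).
have mC (i j : 'I_k) : (i < j)%N -> exists c,
    (x i * x j) ^+ c *: (x j ^+ n *: m i) = (x i * x j) ^+ c *: (x i ^+ n *: m j).
  move=> ij; have := zC i j ij; rewrite !zE to_mullE to_mulrE => /frac_eqP[c e].
  by exists (c + n)%N; rewrite exprD -!scalerA e.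
have [c {}mC] : exists c, forall ij : 'I_k * 'I_k,
    (x ij.1 * x ij.2) ^+ c *: (x ij.2 ^+ n *: m ij.1) =
    (x ij.1 * x ij.2) ^+ c *: (x ij.1 ^+ n *: m ij.2).
  apply: uniform_bound => [[i j] c c' /subnK<- /= e|[i j] /=].
    by rewrite exprD -!scalerA e.
  have [/mC//|/mC[c e]|/val_inj->] := ltngtP i j; last by exists 0%N.
  by exists c; rewrite [x i * _]mulrC e.
(* The exponent c.+1 in place of c makes the final exponent positive. *)
exists (n + c.+1)%N, (fun i => x i ^+ c.+1 *: m i); split=> [|i j|i].
- by rewrite addnS.
- have := mC (i, j); rewrite /= !scalerA => /(congr1 ( *:%R (x i * x j))).
  rewrite !scalerA => e.
  transitivity ((x i * x j * ((x i * x j) ^+ c * x j ^+ n)) *: m i).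
    by congr (_ *: _); rewrite exprMn exprD !exprS; ring.
  by rewrite e; congr (_ *: _); rewrite exprMn exprD !exprS; ring.
- by rewrite zE; apply: frac_eq; rewrite scalerA -exprD.
Qed.

(** The fraction u in M_a is the value at a of the section given by the family
    (m_i / x_i^n), with the comparison at each x_i made in M, where no
    denominator is left. *)
Definition glues (n : nat) (m : 'I_k -> M) (a : R) (u : loc M a) : Prop :=
  exists w N, u = frac a w N /\ forall i, x i ^+ n *: w = a ^+ N *: m i.

(** The numerator of the difference is killed by all x_i^n, hence by a power of
    a. *)
Lemma glues_uniq n m (a : ideal (gens x)) (u u' : loc M (elt a)) :
  glues n m u -> glues n m u' -> u = u'.
Proof.
move=> [w [N [-> wP]]] [w' [N' [-> w'P]]].
apply/frac_eqP; exists (k * n).+1.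
apply/eqP; rewrite -subr_eq0 -scalerBr; apply/eqP.
apply: (gens_torsion a (ltnSn (k * n))) => i.
rewrite scalerBr !scalerA ![x i ^+ n * _]mulrC -!scalerA wP w'P !scalerA.
by rewrite mulrC subrr.
Qed.

(** For a^N = \sum_i b_i x_i^n the numerator \sum_i b_i m_i works, since
    x_j^n \sum_i b_i m_i = \sum_i b_i x_i^n m_j = a^N m_j. *)
Lemma glues_exists n m (a : ideal (gens x)) : compatible n m ->
  exists u : loc M (elt a), glues n m u.
Proof.
move=> mC; have [b bE] := gens_exp_sum a (ltnSn (k * n)).
exists (frac (elt a) (\sum_i b i *: m i) (k * n).+1).
exists (\sum_i b i *: m i), (k * n).+1; split=> // j.
rewrite bE scaler_sumr scaler_suml; apply: eq_bigr => i _.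
by rewrite scalerA mulrC -!scalerA mC.
Qed.

Lemma glues_alpha n m (a b : R) l r (abr : a ^+ l = b * r) (u : loc M b) :
  glues n m u -> glues n m (alpha abr u).
Proof.
move=> [w [N [-> wP]]]; rewrite alphaE; exists (r ^+ N *: w), (l * N)%N.
split=> // i; rewrite scalerA mulrC -scalerA wP scalerA.
by rewrite exprM abr exprMn mulrC.
Qed.

Lemma sigma_surj (z : cech_D0 x M) : exists f, sigma x M f = z.
Proof.
have [n [m [_ mC zE]]] := cech_D0_compatible z.
pose s (a : ideal (gens x)) := cid (glues_exists a mC).
pose f : loc_family (gens x) M := fun a => projT1 (s a).
have fP a : glues n m (f a) by rewrite /f; case: (s a).
have f_compat : f \in @loc_compatible_pred R (gens x) M.
  apply/asboolP => a b l r abr _; apply: (@glues_uniq n m) => //.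
  exact: glues_alpha.
exists (LocLimit f_compat); apply: val_inj.
apply: functional_extensionality_dep => i.
rewrite [RHS]zE; apply: (@glues_uniq n m (gen x i)); first exact: fP.
by exists (m i), n; split=> // j; rewrite mC.
Qed.

(** The value of f at x_i a is determined both by its value at x_i and by its
    value at a. If the former vanishes for all i, the numerator of the latter is
    killed by a power of each x_i, up to powers of a. *)
Lemma sigma_inj : injective (sigma x M).
Proof.
move=> f f' /(congr1 (fun z => kernel_val z)) ff'.
apply: val_inj; apply: functional_extensionality_dep => a.
apply/eqP; rewrite -subr_eq0 -[_ - _]/(loc_proj a f - loc_proj a f').
have zero i : loc_proj (x i *: a) f - loc_proj (x i *: a) f' = 0.
  have e : elt (x i *: a) ^+ 1 = elt (gen x i) * elt a by rewrite expr1.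
  rewrite -!(loc_proj_compat _ e) //.
  by have := congr1 (@^~ i) ff'; rewrite !sigmaE => ->; rewrite subrr.
have e i : elt (x i *: a) ^+ 1 = elt a * x i by rewrite expr1 mulrC.
have {zero} : forall i, alpha (e i) (loc_proj a f - loc_proj a f') = 0.
  move=> i.
  transitivity (alpha (e i) (loc_proj a f) - alpha (e i) (loc_proj a f')).
    exact: linearB.
  by rewrite !(loc_proj_compat _ (e i)) // zero.
elim/loc_ind: (_ - _) => w N zero.
have [c wc] : exists c, forall i, x i ^+ c *: (elt a ^+ c *: w) = 0.
  apply: uniform_bound => [i c c' /subnK<- h|i].
    rewrite -(scaler0 _ ((x i * elt a) ^+ (c' - c))) -h !scalerA.
    by congr (_ *: _); rewrite exprMn !exprD; ring.
  have /frac_eqP[c] : frac (elt (x i *: a)) (x i ^+ N *: w) (1 * N) =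
      frac _ 0 0 by have := zero i; rewrite alphaE.
  rewrite !scaler0 expr0 scale1r => h.
  exists (c + N)%N; rewrite -(scaler0 _ (elt a ^+ N)) -h !scalerA.
  by congr (_ *: _); rewrite -[elt (_ *: _)]/(x i * elt a) exprMn !exprD; ring.
apply/eqP; rewrite -[RHS]/(frac (elt a) 0 0); apply/frac_eqP.
exists ((k * c).+1 + c)%N; rewrite !scaler0 expr0 scale1r exprD -scalerA.
exact: gens_torsion wc.
Qed.

Lemma rho_sigma_theta : rho x M =1 sigma x M \o theta x M.
Proof.
elim/transform_ind=> n f; apply: val_inj.
apply: functional_extensionality_dep => i.
by rewrite [LHS]rhoE [RHS]sigmaE thetaE.
Qed.

(** A map on J^n representing an element of the kernel kills x_i^(c + n) for all
    i and some c, hence kills J^N once J^N lies in (x_1^(c + n), ...). *)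
Lemma rho_inj : injective (rho x M).
Proof.
apply: raddf_inj; elim/transform_ind=> n f /(congr1 (fun z => kernel_val z)) f0.
have [c fc] : exists c, forall i, x i ^+ c *: f (ideal_exp (gen x i) n) = 0.
  apply: uniform_bound => [i c c' /subnK<- h|i].
    by rewrite exprD -scalerA h scaler0.
  have := congr1 (@^~ i) f0; rewrite rhoE => /(@frac_eqP _ _ _ _ _ 0 0)[c].
  by rewrite expr0 scale1r !scaler0; exists c.
(* The summand n keeps n <= N when k = 0. *)
pose N := ((k * (c + n)).+1 + n)%N; have nN : (n <= N)%N by exact: leq_addl.
apply/(transform_class_eqP f (0 : {linear ideal_power (gens x) 0 -> M})).
exists N, nN, (leq0n _); apply: hom_ext => a; rewrite restrictE /=.
have kN : (k * (c + n) < N)%N by rewrite ltnS leq_addr.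
have [b aE] := (mem_gensP _ _).1 (ideal_power_sub_powers kN (eltP a)).
have -> : incl (gens x) nN a = \sum_i (b i * x i ^+ c) *: ideal_exp (gen x i) n.
  apply: val_inj; rewrite [RHS]raddf_sum -[LHS]/(elt a) aE.
  by apply: eq_bigr => i _; rewrite /powers exprD mulrA.
rewrite linear_sum big1 // => i _.
by rewrite linearZ /= -scalerA fc scaler0.
Qed.

End CechCocycles.

(** * The canonical map M -> D_J(M) becomes an isomorphism on localizing *)

Section LocMap.
Context (R : comPzRingType) (M N : lmodType R) (t : {linear M -> N}).

Section At.
Context (a : R).

Let loc_map_fun (p : loc_premodule M a) : loc N a := frac a (t p.1) p.2.

Let loc_map_compat p q : pm_eqv p q -> loc_map_fun p = loc_map_fun q.
Proof.
case: p q => [m n] [m' n'] [c /= e]; apply/frac_eqP; exists c => /=.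
by rewrite -!(linearZZ t) e.
Qed.

Let loc_map_linear c p q : loc_map_fun (pm_add (pm_scale c p) q) =
  c *: loc_map_fun p + loc_map_fun q.
Proof.
case: p q => [m n] [m' n']; rewrite /loc_map_fun /= fracZ fracD.
by rewrite linearD !(linearZZ t).
Qed.

Definition loc_map : {linear loc M a -> loc N a} :=
  lift loc_map_compat loc_map_linear.

Lemma loc_mapE m n : loc_map (frac a m n) = frac a (t m) n.
Proof. exact: liftE. Qed.

Lemma loc_map_inj : (forall m, t m = 0 -> exists n, a ^+ n *: m = 0) ->
  injective loc_map.
Proof.
move=> t_ker; apply: raddf_inj; elim/loc_ind=> m n.
rewrite -[X in X -> _]/(loc_map (frac a m n) = 0) loc_mapE.
move=> /(@frac_eqP _ _ _ _ _ 0 0)[c].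
rewrite expr0 scale1r !scaler0 -(linearZZ t) => /t_ker[p].
rewrite scalerA -exprD => e; apply/(@frac_eqP _ _ _ _ _ 0 0).
by exists (p + c)%N; rewrite expr0 scale1r !scaler0.
Qed.

Lemma loc_map_surj : (forall v, exists n m, a ^+ n *: v = t m) ->
  forall u, exists w, loc_map w = u.
Proof.
move=> t_coker; elim/loc_ind=> v n; have [p [m vE]] := t_coker v.
exists (frac a m (p + n)); rewrite loc_mapE -vE; apply: frac_eq.
by rewrite scalerA -exprD addnC.
Qed.

End At.

Lemma loc_map_alpha (a b : R) l r (h : a ^+ l = b * r) (u : loc M b) :
  loc_map a (alpha h u) = alpha h (loc_map b u).
Proof. by elim/loc_ind: u => m n; rewrite !(alphaE, loc_mapE) (linearZZ t). Qed.

Lemma loc_map_to_mulr (y z : R) (u : loc M y) :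
  loc_map (y * z) (to_mulr y z u) = to_mulr y z (loc_map y u).
Proof. exact: loc_map_alpha. Qed.

Lemma loc_map_to_mull (y z : R) (u : loc M z) :
  loc_map (y * z) (to_mull y z u) = to_mull y z (loc_map z u).
Proof. exact: loc_map_alpha. Qed.

End LocMap.

Section CechOfTransform.
Context (R : comPzRingType) (k : nat) (x : 'I_k -> R) (M : lmodType R).

Definition scale_hom (S : R -> Prop) (m : M) (a : ideal S) : M := elt a *: m.

Let scale_hom_linear S m : linear (@scale_hom S m).
Proof.
move=> c a b; rewrite /scale_hom -[elt _]/(c * elt a + elt b).
by rewrite scalerDl -scalerA.
Qed.

HB.instance Definition _ S m :=
  GRing.isLinear.Build R (ideal S) M *:%R (@scale_hom S m)
    (@scale_hom_linear S m).

(** Stage 0 of the direct limit is Hom(R, M) = M: an element m becomes the map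
    a |-> a m. *)
Definition tau_fun (m : M) : D_J x M :=
  @transform_class R (gens x) M 0 (@scale_hom (ideal_products (gens x) 0) m).

Let tau_linear : linear tau_fun.
Proof.
move=> c m m'; rewrite /tau_fun /transform_class -classZ -classD.
apply/class_eqP; exists 0%N, (leqnn _), (leqnn _); apply: hom_ext => a /=.
by rewrite /scale_hom /= scalerDr !scalerA [c * _]mulrC.
Qed.

HB.instance Definition _ :=
  GRing.isLinear.Build R M (D_J x M) *:%R tau_fun tau_linear.

Definition tau : {linear M -> D_J x M} := tau_fun.

Lemma tau_ker (a : ideal (gens x)) m : tau m = 0 -> exists n, elt a ^+ n *: m = 0.
Proof.
move=> /(transform_class_eqP _ (0 : {linear ideal_power (gens x) 0 -> M})).
case=> N [N0 [N0' e]]; exists N.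
exact: (congr1 (fun f : {linear _ -> _} => f (ideal_exp a N)) e).
Qed.

(** For b in J^n both a^n f(b) and b f(a^n) are f(a^n b). *)
Lemma tau_coker (a : ideal (gens x)) n
    (f : {linear ideal_power (gens x) n -> M}) :
  elt a ^+ n *: (transform_class f : D_J x M) = tau (f (ideal_exp a n)).
Proof.
rewrite /transform_class -classZ; apply/transform_class_eqP.
exists n, (leqnn n), (leq0n n); apply: hom_ext => b /=.
rewrite /scale_hom incl_elt -!linearZ; congr (f _); apply: elt_inj.
exact: mulrC.
Qed.

Lemma loc_tau_inj (a : ideal (gens x)) : injective (loc_map tau (elt a)).
Proof. by apply: loc_map_inj => m; exact: tau_ker. Qed.

Lemma loc_tau_surj (a : ideal (gens x)) (u : loc (D_J x M) (elt a)) :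
  exists w, loc_map tau (elt a) w = u.
Proof.
apply: loc_map_surj; elim/transform_ind=> n f.
by exists n, (f (ideal_exp a n)); exact: tau_coker.
Qed.

Lemma loc_tau_rho (d : D_J x M) i :
  loc_map tau (x i) (kernel_val (rho x M d) i) = cech_d0 x (D_J x M) d i.
Proof.
elim/transform_ind: d => n f; rewrite rhoE loc_mapE -(tau_coker (gen x i)).
by apply: frac_eq; rewrite expr0 scale1r.
Qed.

Lemma loc_tau_cech_ker (w : cech1 x M) :
  ((fun i => loc_map tau (x i) (w i)) : cech1 x (D_J x M))
    \in ker (cech_d1 x (D_J x M)) = (w \in ker (cech_d1 x M)).
Proof.
apply/cech_kerP/cech_kerP => wC i j ij.
  have tau_inj : injective (loc_map tau (x i * x j)).
    exact: (@loc_tau_inj (x i *: gen x j)).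
  by apply: tau_inj; rewrite loc_map_to_mull loc_map_to_mulr wC.
by rewrite -loc_map_to_mull -loc_map_to_mulr wC.
Qed.

(** Under the isomorphism between cocycles for M and for D_J(M), the image of rho
    is the image of d^0. *)
Lemma rho_surj_iff_cech_H1_0 :
  (forall z, exists d, rho x M d = z) <-> (forall u : cech_H1 x (D_J x M), u = 0).
Proof.
split=> [rho_surj|H1_0 [w wC]].
  elim/quotient_ind=> -[z zC]; apply/homology_class_eq0 => /=.
  have /fin_all_exists[w wE] i := loc_tau_surj (a := gen x i) (z i).
  have {}wE : (fun i => loc_map tau (x i) (w i)) = z.
    by apply: functional_extensionality_dep.
  move: zC; rewrite -wE loc_tau_cech_ker => wC.
  have [d rho_d] := rho_surj (Kernel wC).
  exists d; apply: functional_extensionality_dep => i.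
  by rewrite -loc_tau_rho rho_d.
have zC := wC; rewrite -loc_tau_cech_ker in zC.
have /homology_class_eq0[d d0_d] := H1_0 (homology_class _ (Kernel zC)).
exists d; apply: val_inj; apply: functional_extensionality_dep => i.
apply: (@loc_tau_inj (gen x i)); rewrite loc_tau_rho d0_d.
by [].
Qed.

End CechOfTransform.

(** * The Koszul complex in low degrees *)

Section KoszulDegreeOne.
Context (R : comPzRingType) (k : nat) (x : 'I_k -> R).

Definition chain1 (b : 'I_k -> R) : koszul k R^o 1 :=
  [ffun T : psubset k 1 => \sum_(i in val T) b i : R^o].

Definition basis1 (i : 'I_k) : koszul k R^o 1 := chain1 (fun j => (j == i)%:R).

Definition basis2 (i j : 'I_k) : koszul k R^o 2 :=
  [ffun T : psubset k 2 => (val T == [set i; j])%:R : R^o].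

Lemma psubset1P (T : psubset k 1) : exists i, val T = [set i].
Proof. by apply/cards1P; exact: (valP T). Qed.

Lemma koszul1_ext (f g : koszul k R^o 1) :
  (forall i, koszul_coef f [set i] = koszul_coef g [set i]) -> f = g.
Proof.
move=> fg; apply/ffunP => T; rewrite -!koszul_coef_val.
by have [i ->] := psubset1P T.
Qed.

(** A chain defined by a formula in the subset may be read off at any singleton
    without the proof that it has one element. *)
Lemma koszul_coef1E (F : psubset k 1 -> R^o) (G : {set 'I_k} -> R^o) i :
  (forall T, F T = G (val T)) ->
  koszul_coef ([ffun T => F T] : koszul k R^o 1) [set i] = G [set i].
Proof.
move=> FG; have i1 : #|[set i]| == 1%N by rewrite cards1.
pose T : psubset k 1 := exist (fun T : {set 'I_k} => #|T| == 1%N) [set i] i1.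
by rewrite -[[set i]]/(val T) koszul_coef_val ffunE FG.
Qed.

Lemma koszul_coef_chain1 (b : 'I_k -> R) i : koszul_coef (chain1 b) [set i] = b i.
Proof.
by rewrite (@koszul_coef1E _ (fun T => \sum_(i in T) b i)) // big_set1.
Qed.

(** Taking a coefficient is linear, which reduces the claim to basis vectors. *)
Lemma koszul1_sum (f : koszul k R^o 1) :
  f = \sum_i koszul_coef f [set i] *: basis1 i.
Proof.
apply/ffunP => T; rewrite -!koszul_coef_val; have [i ->] := psubset1P T.
rewrite -[RHS]/(koszul_coef _ [set i]).
pose c := @koszul_coef R k R^o 1 ^~ [set i].
have c_lin : linear c by move=> a g h; exact: koszul_coefP.
pose C : {linear koszul k R^o 1 -> R^o} :=
  HB.pack_for {linear koszul k R^o 1 -> R^o} c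
    (GRing.isLinear.Build R _ _ *:%R c c_lin).
rewrite -[RHS]/(C _) linear_sum.
rewrite (eq_bigr (fun j => koszul_coef f [set j] * (i == j)%:R)) => [|j _].
  rewrite (bigD1 i) //= eqxx mulr1 big1 ?addr0 // => j ji.
  by rewrite eq_sym (negbTE ji) mulr0.
by rewrite (linearZZ C) -(koszul_coef_chain1 (fun l => (l == j)%:R)).
Qed.

Lemma koszul_diff1E (y : 'I_k -> R) (f : koszul k R^o 1) (T : psubset k 0) :
  koszul_diff R^o y 1 0 f T = \sum_i koszul_coef f [set i] * y i.
Proof.
have T0 : val T = set0 by apply/eqP; rewrite -cards_eq0; exact: (valP T).
rewrite ffunE T0; apply: eq_big => [i|i _]; first by rewrite inE.
rewrite setU0 /koszul_sign (_ : [set j in set0 | _] = set0) ?cards0 ?mul1r.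
  exact: mulrC.
by apply/setP => j; rewrite !inE.
Qed.

Lemma koszul_diff2E (y : 'I_k -> R) (g : koszul k R^o 2) (i : 'I_k) :
  koszul_coef (koszul_diff R^o y 2 1 g) [set i] =
  \sum_(j | j != i) (-1) ^+ (i < j)%N * y j * koszul_coef g [set j; i].
Proof.
rewrite (@koszul_coef1E _ (fun T => \sum_(j | j \notin T)
  (koszul_sign R j T * y j) *: koszul_coef g (j |: T))) //.
apply: eq_big => [j|j _]; first by rewrite inE.
rewrite /koszul_sign; congr (_ ^+ _ * _ * _).
rewrite (_ : [set _ in _ | _] = if (i < j)%N then [set i] else set0).
  by case: ifP; rewrite ?cards1 ?cards0.
apply/setP => l; rewrite !inE.
by case: eqP => [->|]; case: ifP; rewrite ?inE ?eqxx //; case: eqP.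
Qed.

Lemma koszul_transE m n (f : koszul k R^o 1) (i : 'I_k) :
  koszul_coef (koszul_trans x R^o m n 1 f) [set i] =
  x i ^+ (m - n) * koszul_coef f [set i].
Proof.
rewrite (@koszul_coef1E _ (fun T =>
  (\prod_(i in T) x i ^+ (m - n)) *: koszul_coef f T)).
  by rewrite big_set1.
by move=> T; rewrite koszul_coef_val.
Qed.

Lemma koszul_coef_basis2 (i j t l : 'I_k) : t != l ->
  koszul_coef (basis2 i j) [set t; l] = ([set t; l] == [set i; j])%:R.
Proof.
move=> tl; have tl2 : #|[set t; l]| == 2 by rewrite cards2 tl.
pose T : psubset k 2 := exist (fun T : {set 'I_k} => #|T| == 2) [set t; l] tl2.
by rewrite -[[set t; l]]/(val T) koszul_coef_val ffunE.
Qed.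

(** The relations that define the cokernel of K_2 -> K_1. *)
Lemma koszul_diff_basis2 (y : 'I_k -> R) (i j : 'I_k) : (i < j)%N ->
  koszul_diff R^o y 2 1 (basis2 i j) = y i *: basis1 j - y j *: basis1 i.
Proof.
move=> ij; have ij' : i != j by rewrite -val_eqE /=; case: ltngtP ij.
apply: koszul1_ext => l; rewrite koszul_diff2E addrC -scaleNr koszul_coefP.
rewrite -[y i *: basis1 j]addr0 koszul_coefP !koszul_coef_chain1.
rewrite (_ : koszul_coef 0 _ = 0) ?addr0; last first.
  by rewrite /koszul_coef; case: insubP => //= T _ _; rewrite ffunE.
rewrite (eq_bigr _ (fun t tl => congr1 _ (koszul_coef_basis2 i j tl))).
have [->|li] := eqVneq l i.
  rewrite (negbTE ij') scaler0 addr0 (bigD1 j) 1?eq_sym //= big1 => [|t].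
    by rewrite setUC eqxx ij expr1 mulN1r addr0.
  case/andP=> ti tj; rewrite (_ : (_ == _) = false) ?mulr0 //.
  by apply/eqP => /setP/(_ t); rewrite !inE eqxx (negbTE ti) (negbTE tj).
rewrite scaler0 add0r; have [->|lj] := eqVneq l j.
  rewrite (bigD1 i) //= big1 => [|t].
    by rewrite eqxx ltnNge (ltnW ij) mul1r addr0.
  case/andP=> tj ti; rewrite (_ : (_ == _) = false) ?mulr0 //.
  by apply/eqP => /setP/(_ t); rewrite !inE eqxx (negbTE ti) (negbTE tj).
rewrite scaler0 big1 // => t tl; rewrite (_ : (_ == _) = false) ?mulr0 //.
by apply/eqP => /setP/(_ l); rewrite !inE eqxx orbT (negbTE li) (negbTE lj).
Qed.

End KoszulDegreeOne.

(** * Pro-zero Koszul homology and surjectivity of rho *)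

Section Cokernel.
Context (R : comPzRingType) (A B : lmodType R) (d : {linear A -> B}).

(** Homology at B of A -> B -> B with the second map zero, which makes all of B a
    kernel. *)
Definition coker : lmodType R := homology d (0 : {linear B -> B}).

Let ker0 (b : B) : b \in ker (0 : {linear B -> B}).
Proof. by rewrite inE. Qed.

Definition coker_proj_fun (b : B) : coker := homology_class d (Kernel (ker0 b)).

Let coker_proj_linear : linear coker_proj_fun.
Proof.
move=> a b b'; rewrite /coker_proj_fun /homology_class -classZ -classD.
by congr class; apply: val_inj; rewrite [RHS]linearP.
Qed.

HB.instance Definition _ :=
  GRing.isLinear.Build R B coker *:%R coker_proj_fun coker_proj_linear.

Definition coker_proj : {linear B -> coker} := coker_proj_fun.

Lemma coker_proj_eq0 b : coker_proj b = 0 <-> exists a, d a = b.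
Proof. exact: homology_class_eq0. Qed.

End Cokernel.

Section ProZero.
Context (R : comPzRingType) (k : nat) (x : 'I_k -> R).

(** A choice of coordinates of each element defines the map; the hypothesis on
    relations makes the value independent of the choice, hence linear. *)
Lemma hom_of_relations (M : lmodType R) (y : 'I_k -> R) (v : 'I_k -> M)
    (S : R -> Prop) :
  (forall a, a \in ideal_pred S -> a \in ideal_pred (gens y)) ->
  (forall b : 'I_k -> R, \sum_i b i * y i = 0 -> \sum_i b i *: v i = 0) ->
  exists f : {linear ideal S -> M}, forall (a : ideal S) (b : 'I_k -> R),
    elt a = \sum_i b i * y i -> f a = \sum_i b i *: v i.
Proof.
move=> Sy v_rel.
have /choice[c cE] (a : ideal S) : exists b : 'I_k -> R, elt a = \sum_i b i * y i.
  by apply/mem_gensP/Sy/eltP.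
pose f a := \sum_i c a i *: v i.
have fE a b : elt a = \sum_i b i * y i -> f a = \sum_i b i *: v i.
  move=> ab; apply/eqP; rewrite -subr_eq0 -sumrB; apply/eqP.
  rewrite (eq_bigr (fun i => (c a i - b i) *: v i)) => [|i _]; last first.
    by rewrite scalerBl.
  apply: v_rel; rewrite (eq_bigr (fun i => c a i * y i - b i * y i)).
    by rewrite sumrB -cE -ab subrr.
  by move=> i _; rewrite mulrBl.
have f_linear : linear f.
  move=> r a a'; rewrite (fE _ (fun i => r * c a i + c a' i)); last first.
    rewrite -[LHS]/(r * elt a + elt a') !cE mulr_sumr -big_split /=.
    by apply: eq_bigr => i _; rewrite mulrDl mulrA.
  rewrite scaler_sumr -big_split /=; apply: eq_bigr => i _.
  by rewrite scalerDl scalerA.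
by exists (HB.pack_for {linear ideal S -> M} f
  (GRing.isLinear.Build R (ideal S) M *:%R f f_linear)).
Qed.

(** A relation b is a cycle of K_1(x^(m); R). Its image (x_i^(m - n) b_i)_i is a
    boundary, that is a combination of the x_j^n e_i - x_i^n e_j, and each of
    these goes to zero under e_i |-> v_i because v is compatible. *)
Lemma pro_zero_relations (M : lmodType R) (n m : nat) (nm : (n <= m)%N)
    (v : 'I_k -> M) (b : 'I_k -> R) :
  (forall u, koszul_map x R^o nm 1 u = 0) -> compatible x n v ->
  \sum_i b i * x i ^+ m = 0 -> \sum_i b i *: (x i ^+ (m - n) *: v i) = 0.
Proof.
move=> H1_0 vC b0.
have chain1_ker : chain1 b \in ker (koszul_diff R^o (powers x m) 1 0).
  rewrite inE; apply/eqP/ffunP => T; rewrite koszul_diff1E ffunE.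
  by rewrite -[RHS]b0; apply: eq_bigr => i _; rewrite koszul_coef_chain1.
have := H1_0 (homology_class _ (Kernel chain1_ker)).
rewrite homology_mapE => /homology_class_eq0[g].
rewrite -[\val _]/(koszul_trans x R^o m n 1 (chain1 b)) => gE.
have bE i : x i ^+ (m - n) * b i =
    \sum_(j | j != i) (-1) ^+ (i < j)%N * x j ^+ n * koszul_coef g [set j; i].
  have := congr1 (fun f => koszul_coef f [set i]) gE.
  by rewrite koszul_diff2E koszul_transE koszul_coef_chain1 => <-.
rewrite (eq_bigr (fun i : 'I_k => \sum_(j : 'I_k | j != i)
  ((-1) ^+ (i < j)%N * x j ^+ n * koszul_coef g [set j; i]) *: v i)) => [|i _].
  apply: (@sum_skew _ _ (fun i j : 'I_k => _ *: v i)) => i j ij.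
  rewrite -scaleNr ![_ * _ ^+ n * _]mulrAC -scalerA vC scalerA setUC.
  congr (_ *: _); rewrite -!mulrA -mulNr; congr (_ * _).
  by move: ij; rewrite -val_eqE /=; case: ltngtP; rewrite // ?opprK.
by rewrite scalerA mulrC bE scaler_suml.
Qed.

(** The map x_i^m |-> x_i^(m - n) v_i on (x_1^m, ..., x_k^m), restricted to J^N,
    represents a preimage of the cocycle (v_i / x_i^n)_i. *)
Lemma rho_surj_of_pro_zero : koszul_pro_zero x R^o 1 ->
  forall (M : lmodType R) (z : cech_D0 x M), exists d, rho x M d = z.
Proof.
move=> pro_zero M z; have [n [v [n0 vC zE]]] := cech_D0_compatible z.
have [m [nm H1_0]] := pro_zero n n0.
have kmN := ltnSn (k * m); set N := (k * m).+1 in kmN.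
have [f fE] : exists f : {linear ideal_power (gens x) N -> M}, forall a b,
    elt a = \sum_i b i * x i ^+ m -> f a = \sum_i b i *: (x i ^+ (m - n) *: v i).
  apply: hom_of_relations => [a|b]; first exact: ideal_power_sub_powers.
  exact: pro_zero_relations.
exists (transform_class f); apply: val_inj.
apply: functional_extensionality_dep => i; rewrite [LHS]rhoE [RHS]zE.
(* The existence of i gives k > 0, hence m <= k m. *)
have mN : (m <= N)%N by rewrite /N; have := ltn_ord i; nia.
rewrite (fE _ (fun j => (j == i)%:R * x i ^+ (N - m))).
  rewrite (bigD1 i) //= big1 => [|j /negbTE->]; last by rewrite mul0r scale0r.
  rewrite eqxx mul1r addr0; apply: frac_eq; rewrite !scalerA -!exprD.
  by congr (_ ^+ _ *: _); lia.
rewrite (bigD1 i) //= big1 => [|j /negbTE->]; last by rewrite !mul0r.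
by rewrite eqxx mul1r addr0 -exprD subnK.
Qed.

(** Surjectivity of rho for the cokernel Q of K_2(x^(n)) -> K_1(x^(n)) provides
    f : J^N -> Q with f(x_i^m) = x_i^(m - n) e_i for some large m. Applied to a
    relation \sum_i b_i x_i^m = 0, it shows that \sum_i b_i x_i^(m - n) e_i
    vanishes in Q, i.e. that the image of the cycle b is a boundary. *)
Lemma pro_zero_of_rho_surj :
  (forall (M : lmodType R) (z : cech_D0 x M), exists d, rho x M d = z) ->
  koszul_pro_zero x R^o 1.
Proof.
move=> rho_surj n _; pose q := coker_proj (koszul_diff R^o (powers x n) 2 1).
have e_ker : ((fun i => frac (x i) (q (basis1 R i)) n) : cech1 x _)
    \in ker (cech_d1 x (coker (koszul_diff R^o (powers x n) 2 1))).
  apply: compatible_ker => i j ij; apply/eqP; rewrite eq_sym -subr_eq0.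
  rewrite -!linearZZ -linearB; apply/eqP/coker_proj_eq0.
  by exists (basis2 R i j); rewrite koszul_diff_basis2.
have [d] := rho_surj _ (Kernel e_ker).
elim/transform_ind: d => N f /(congr1 (fun z => kernel_val z)) fE.
have [c {}fE] : exists c, forall i,
    x i ^+ (c + n) *: f (ideal_exp (gen x i) N) =
    x i ^+ (c + N) *: q (basis1 R i).
  apply: uniform_bound => [i c c' /subnK<- e|i].
    by rewrite -!addnA !(exprD _ (c' - c)) -!scalerA e.
  have := congr1 (@^~ i) fE; rewrite rhoE => /frac_eqP[c].
  by rewrite !scalerA -!exprD; exists c.
have nm : (n <= c + n + N)%N by lia.
exists (c + n + N)%N, nm; elim/quotient_ind=> z.
rewrite -[class z]/(homology_class _ z) homology_mapE.
apply/homology_class_eq0/coker_proj_eq0 => /=.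
set u := koszul_trans _ _ _ _ _ _.
pose b i : R := koszul_coef (val z) [set i].
(* The cycle condition on z, as an equation in J^N, where f is defined. *)
have b0 : \sum_i (b i * x i ^+ (c + n)) *: ideal_exp (gen x i) N = 0.
  apply: val_inj; rewrite raddf_sum /=.
  have T0 : #|set0 : {set 'I_k}| == 0%N by rewrite cards0.
  pose T : psubset k 0 := exist (fun T : {set 'I_k} => #|T| == 0%N) set0 T0.
  have := congr1 (fun f : koszul k R^o 0 => f T) (kernelP z).
  rewrite koszul_diff1E [RHS]ffunE => dz; rewrite -[RHS]dz.
  apply: eq_bigr => i _; rewrite -[LHS]/(b i * x i ^+ (c + n) * x i ^+ N).
  by rewrite -mulrA -exprD.
rewrite (koszul1_sum u) linear_sum -[RHS](linear0 f) -b0 linear_sum.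
apply: eq_bigr => i _; rewrite (linearZZ q) (linearZZ f) koszul_transE.
rewrite -[RHS]scalerA fE scalerA.
by congr (_ *: _); rewrite mulrC; congr (_ * _ ^+ _); lia.
Qed.

End ProZero.

(** * Reduction of all bijectivity statements to surjectivity of rho *)

Section Bijectivity.
Context (R : comPzRingType) (k : nat) (x : 'I_k -> R) (M : lmodType R).

Lemma sigma_bij : bijective (sigma x M).
Proof. exact: inj_surj_bijective (@sigma_inj R k x M) (@sigma_surj R k x M). Qed.

Lemma theta_inj : injective (theta x M).
Proof.
move=> d d' e; apply: (@rho_inj R k x M); rewrite !rho_sigma_theta.
exact: congr1 e.
Qed.

Lemma rho_bij_surj :
  bijective (rho x M) <-> forall z, exists d, rho x M d = z.
Proof.
split=> [[g _ gK] z|]; first by exists (g z).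
exact: inj_surj_bijective (@rho_inj R k x M).
Qed.

Lemma theta_bij_rho : bijective (theta x M) <-> bijective (rho x M).
Proof.
split=> [theta_bij|rho_bij].
  apply: (eq_bij (bij_comp sigma_bij theta_bij)) => d.
  by rewrite rho_sigma_theta.
apply: inj_surj_bijective theta_inj _ => f.
have [d rho_d] := rho_bij_surj.1 rho_bij (sigma x M f).
by exists d; apply: (@sigma_inj R k x M); rewrite -rho_d rho_sigma_theta.
Qed.

End Bijectivity.

Theorem theorem1p1 (R : comPzRingType) (k : nat) (x : 'I_k -> R) :
  (forall M : lmodType R, rho x M =1 sigma x M \o theta x M) /\
  (forall M : lmodType R,
     [/\ injective (theta x M), injective (rho x M) & bijective (sigma x M)]) /\
  (forall M : lmodType R,
     (bijective (theta x M) <-> (forall u : cech_H1 x (D_J x M), u = 0)) /\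
     (bijective (rho x M) <-> (forall u : cech_H1 x (D_J x M), u = 0))) /\
  ((forall M : lmodType R, bijective (theta x M)) <-> koszul_pro_zero x R^o 1) /\
  ((forall M : lmodType R, bijective (rho x M)) <-> koszul_pro_zero x R^o 1).
Proof.
have rho_H1 M : bijective (rho x M) <-> (forall u : cech_H1 x (D_J x M), u = 0).
  by rewrite rho_bij_surj rho_surj_iff_cech_H1_0.
have rho_pro_zero :
    (forall M : lmodType R, bijective (rho x M)) <-> koszul_pro_zero x R^o 1.
  split=> [rho_bij|pro_zero M].
    by apply: pro_zero_of_rho_surj => M; apply/rho_bij_surj.
  by apply/rho_bij_surj; exact: rho_surj_of_pro_zero.
split; first exact: rho_sigma_theta.
split=> [M|].
  by split; [exact: theta_inj | exact: rho_inj | exact: sigma_bij].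
split; first by move=> M; rewrite theta_bij_rho.
split=> //; rewrite -rho_pro_zero.
by split=> bij M; apply/theta_bij_rho.
Qed.
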